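(* Let $\mathcal{G}$ be a class of graphs with bounded expansion and $k\ge 1$ a constant integer. There exist a constant $C$ (depending on $\mathcal{G}$ and $k$) and an algorithm that for each $G\in\mathcal{G}$ returns a $k$-dominating set $D$ and a $(2k+1)$-independent set $A$ of $G$ such that $|D|\le C|A|$. The algorithm runs in time $O(|V(G)|)$.
   Context: A class $\mathcal{G}$ of finite undirected graphs has bounded expansion if there is a function $f$ such that for every $G\in\mathcal{G}$ and every integer $r\ge 0$, every graph $H$ obtained from a subgraph of $G$ by contracting pairwise vertex-disjoint connected subgraphs each of radius at most $r$ satisfies $|E(H)|/|V(H)|\le f(r)$. A set $D\subseteq V(G)$ is $k$-dominating if every vertex of $G$ is at distance at most $k$ from some vertex of $D$. A set $A\subseteq V(G)$ is $d$-independent if the distance in $G$ between every two distinct vertices of $A$ is greater than $d$. *)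

(* Defs.v *)
From mathcomp Require Import all_boot.

Set Implicit Arguments.
Unset Strict Implicit.
Unset Printing Implicit Defensive.

Record sgraph := SGraph {
  vertex :> finType;
  edge : rel vertex;
  edge_sym : symmetric edge;
  edge_irrefl : irreflexive edge }.
Arguments edge {s}.

Definition edges (G : sgraph) : {set {set G}} :=
  [set [set p.1; p.2] | p in [pred p : G * G | edge p.1 p.2]].

(* [dist_le e d u v]: the distance from u to v is at most d, in the graph with
   edge relation e; it never holds between different components. *)
Definition dist_le (T : eqType) (e : rel T) (d : nat) (u v : T) : Prop :=
  exists p : seq T, [/\ path e u p, last u p = v & size p <= d].

Definition k_dominating (G : sgraph) (k : nat) (D : {set G}) : Prop :=
  forall v : G, exists2 u : G, u \in D & dist_le edge k u v.

Definition d_independent (G : sgraph) (d : nat) (A : {set G}) : Prop :=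
  forall u v : G, u \in A -> v \in A -> u != v -> ~ dist_le edge d u v.

(* Subgraphs are taken up to isomorphism. *)
Definition subgraph (S G : sgraph) : Prop :=
  exists2 i : S -> G, injective i & forall u v : S, edge u v -> edge (i u) (i v).

(* H arises from S by contracting disjoint connected subgraphs of radius at most
   r: [phi] sends each vertex of S to the vertex of H that it becomes.  A vertex
   left uncontracted is a fiber of radius 0.  Taking the contracted subgraphs to
   be induced loses nothing, since extra edges only decrease the radius.  Loops
   and parallel edges that arise are discarded. *)
Definition contraction (r : nat) (S H : sgraph) : Prop :=
  exists phi : S -> H,
    (forall h : H, exists2 c : S, phi c = h &
       forall v : S, phi v = h ->
         dist_le [rel x y | [&& edge x y, phi x == h & phi y == h]] r c v) /\
    (forall h h' : H, edge h h' <->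
       h <> h' /\ exists u v : S, [/\ phi u = h, phi v = h' & edge u v]).

(* The density bound |E(H)| / |V(H)| <= f r is written without division; a
   real-valued f can be replaced by its ceiling. *)
Definition bounded_expansion (GG : sgraph -> Prop) : Prop :=
  exists f : nat -> nat, forall G : sgraph, GG G ->
    forall (r : nat) (S H : sgraph), subgraph S G -> contraction r S H ->
      #|edges H| <= f r * #|{: H}|.

(* Word RAM: while-programs over scalar variables and arrays, both named by
   natural numbers.  A program mentions only finitely many of them. *)

Inductive expr :=
  | Const of nat
  | Var of nat
  | Get of nat & expr
  | Add of expr & expr
  | Sub of expr & expr.

Inductive cmd :=
  | Skip
  | Assign of nat & expr
  | Put of nat & expr & expr
  | Seq of cmd & cmd
  | If of expr & cmd & cmd
  | While of expr & cmd.

Record state := State { var : nat -> nat; arr : nat -> nat -> nat }.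

Definition upd (X : Type) (f : nat -> X) (i : nat) (x : X) : nat -> X :=
  fun j => if j == i then x else f j.

Definition set_var (s : state) (x v : nat) : state :=
  State (upd (var s) x v) (arr s).

Definition set_arr (s : state) (a i v : nat) : state :=
  State (var s) (upd (arr s) a (upd (arr s a) i v)).

Fixpoint eval (s : state) (e : expr) : nat :=
  match e with
  | Const n => n
  | Var x => var s x
  | Get a e1 => arr s a (eval s e1)
  | Add e1 e2 => eval s e1 + eval s e2
  | Sub e1 e2 => eval s e1 - eval s e2
  end.

(* Every value met while evaluating e, array indices included, is at most W. *)
Fixpoint fits (W : nat) (s : state) (e : expr) : bool :=
  (eval s e <= W) &&
  match e with
  | Const _ | Var _ => true
  | Get _ e1 => fits W s e1
  | Add e1 e2 | Sub e1 e2 => fits W s e1 && fits W s e2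
  end.

Fixpoint ecost (e : expr) : nat :=
  match e with
  | Const _ | Var _ => 1
  | Get _ e1 => (ecost e1).+1
  | Add e1 e2 | Sub e1 e2 => (ecost e1 + ecost e2).+1
  end.

(* [exec W c s t s']: from state s, command c halts in state s' after t unit-cost
   steps, all values computed on the way being at most W.  A computation that
   would exceed W is stuck, so that W bounds the word size; this prevents packing
   unbounded data into one cell.  In conditions, nonzero means true. *)
Inductive exec (W : nat) : cmd -> state -> nat -> state -> Prop :=
  | ExecSkip s : exec W Skip s 1 s
  | ExecAssign s x e of fits W s e :
      exec W (Assign x e) s (ecost e).+1 (set_var s x (eval s e))
  | ExecPut s a i e of fits W s i & fits W s e :
      exec W (Put a i e) s (ecost i + ecost e).+1
        (set_arr s a (eval s i) (eval s e))
  | ExecSeq s1 s2 s3 c1 c2 t1 t2 of exec W c1 s1 t1 s2 & exec W c2 s2 t2 s3 :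
      exec W (Seq c1 c2) s1 (t1 + t2).+1 s3
  | ExecIfT s s' e c1 c2 t of
      fits W s e & eval s e != 0 & exec W c1 s t s' :
      exec W (If e c1 c2) s (ecost e + t).+1 s'
  | ExecIfF s s' e c1 c2 t of
      fits W s e & eval s e == 0 & exec W c2 s t s' :
      exec W (If e c1 c2) s (ecost e + t).+1 s'
  | ExecWhileT s1 s2 s3 e c t1 t2 of
      fits W s1 e & eval s1 e != 0 & exec W c s1 t1 s2 &
      exec W (While e c) s2 t2 s3 :
      exec W (While e c) s1 (ecost e + t1 + t2).+1 s3
  | ExecWhileF s e c of fits W s e & eval s e == 0 :
      exec W (While e c) s (ecost e).+1 s.

Lemma exec_det W c s t1 s1 : exec W c s t1 s1 ->
  forall t2 s2, exec W c s t2 s2 -> t1 = t2 /\ s1 = s2.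
Proof.
elim=> {c s t1 s1} *;
  match goal with h : exec _ _ _ _ ?s |- _ = _ /\ _ = ?s =>
    inversion h; subst end;
  repeat match goal with
  | ih : (forall t s, exec ?W ?c ?s1 t s -> _), h : exec ?W ?c ?s1 _ _ |- _ =>
      case: (ih _ _ h) => ? ?; subst; clear h
  | ne : is_true (?x != 0), eq0 : is_true (?x == 0) |- _ => by rewrite eq0 in ne
  end; by [].
Qed.

(* An adjacency-list presentation of G: an arbitrary numbering of the vertices
   and, for each vertex, its neighbors in an arbitrary order. *)
Record adjlists (G : sgraph) := AdjLists {
  verts : seq G;
  nbrs : G -> seq G;
  vertsP : perm_eq verts (enum {: G});
  nbrsP : forall v : G, perm_eq (nbrs v) (enum [pred w | edge v w]) }.

Definition num (G : sgraph) (I : adjlists G) (v : G) : nat := index v (verts I).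

(* Variable 0 holds |V(G)|; array 1 holds the concatenated neighbor lists, the
   list of vertex number i < |V(G)| occupying the positions j with
   (array 0)[i] <= j < (array 0)[i+1].  Everything else is 0. *)
Definition input (G : sgraph) (I : adjlists G) : state :=
  State
    (fun x => if x == 0 then #|{: G}| else 0)
    (fun a i =>
       match a with
       | 0 => if i <= #|{: G}|
              then sumn (take i [seq size (nbrs I v) | v <- verts I]) else 0
       | 1 => nth 0
                (flatten [seq [seq num I w | w <- nbrs I v] | v <- verts I]) i
       | _ => 0
       end).

(* The vertex set whose characteristic vector is stored in array a. *)
Definition output (G : sgraph) (I : adjlists G) (s : state) (a : nat) : {set G} :=
  [set v | arr s a (num I v) != 0].

(* Main.v *)
Require Import Defs.
From mathcomp Require Import all_boot zify.

Set Implicit Arguments.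
Unset Strict Implicit.
Unset Printing Implicit Defensive.

(** Every vertex gets boundedly many weighted arcs, level by level.  Level 1
   orients the edges of the graph; level [d] orients the new pairs [{a, b}] such
   that some vertex has an arc of weight [l] to [a] and one of weight [d - l] to
   [b].  Each arc of weight [d] comes from a walk of length at most [d], and every
   vertex is interior to boundedly many of these walks; hence the pairs of a level
   are shallow topological minors up to a constant congestion, they are sparse by
   bounded expansion, and repeatedly giving the pairs to vertices of small degree
   in the remaining set orients them in linear time.

   A walk between [u] and [v] of length at most [2 k + 1] can be shortened as long
   as it leaves an inner vertex by two outgoing arcs.  So [u] and [v] have a common
   hub: a vertex reached from both along arcs of total weight at most [2 k + 1],
   and therefore within weight [k] from one of them.

   Greedily, a vertex none of whose hubs within weight [k] is owned becomes the
   owner of all of them.  The owned vertices form the dominating set.  Two owners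
   at distance at most [2 k + 1] conflict, in that one of them owns a hub of the
   other; each owner causes boundedly many conflicts, so a constant fraction of the
   owners has bounded degree in the conflict graph, and a greedy choice among these
   gives the independent set.

   Since stored values grow only by constants and by [|V(G)|] in each step, linear
   time already bounds all values by a polynomial. *)

(** * Density of graphs of short walks *)

(** New arcs are added only for forks. Consecutive arcs are composed as words over the letters, so a
    hub is the end of a word, and the words of bounded weight are constant in number, as each vertex
    has at most one arc per letter.

    The pairs of a level form a graph that need not lie in the class or among its shallow minors, so
    bounded expansion says nothing about it directly. For this reason every arc keeps a walk of [G]
    that realizes it, and each density bound is derived from minors of [G] itself. The price is that
    the congestion of these walks must be carried along, since the walks of one level are spliced
    from those of earlier ones. Widths, congestions and densities are then computed from [f] and the
    level alone, so one program serves the whole class.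

    Linear time rests on three points: the loop bodies are unrolled over letters and words;
    repetitions among the pairs are detected by a quadratic table that is zero from the start and
    hence costs nothing to clear; and each pass over the queue at least halves it, so that the
    passes form a geometric series. *)

Lemma card_le_fibers (A B : finType) (f : A -> B) (X : {set A}) c :
  (forall y, #|[set x in X | f x == y]| <= c) -> #|X| <= c * #|f @: X|.
Proof.
move=> Hc; rewrite -sum1_card (partition_big_imset f) /= mulnC -sum_nat_const.
by apply: leq_sum => y _; rewrite sum1dep_card; apply: Hc.
Qed.

Lemma card_arcs_le (H : sgraph) :
  #|[set p : H * H | edge p.1 p.2]| <= 2 * #|edges H|.
Proof.
have -> : edges H = (fun p : H * H => [set p.1; p.2]) @:
    [set p : H * H | edge p.1 p.2].
  by apply/setP => y; apply/imsetP/imsetP => -[p Ep ->]; exists p; rewrite ?inE in Ep *.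
apply: card_le_fibers => y.
case: (set_0Vmem [set x in [set p : H * H | edge p.1 p.2] | [set x.1; x.2] == y]) => [->|[[a b]]].
  by rewrite cards0.
rewrite !inE /= => /andP[Eab /eqP <-].
apply: (@leq_trans #|[set (a, b); (b, a)]|); last by rewrite cards2; case: (_ == _).
apply/subset_leq_card/subsetP => -[c d]; rewrite !inE /= !xpair_eqE.
case/andP=> Ecd /eqP /setP Es.
have:= set21 c d; have:= set22 c d; rewrite !Es !inE.
have ncd : c != d by apply/eqP=> cd; rewrite cd edge_irrefl in Ecd.
by move=> /orP[] /eqP E1 /orP[] /eqP E2; rewrite E1 E2 ?eqxx ?orbT // in ncd *.
Qed.

(** * Contracting walks with disjoint interiors *)

Section Contract.
Variables (G : sgraph) (r : nat) (U : {set G}) (M : {set G * G}) (J : G * G -> seq G).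
Hypothesis MU : forall e, e \in M -> e.1 \in U /\ e.2 \in U.
Hypothesis Mpath : forall e, e \in M -> path edge e.1 (rcons (J e) e.2).
Hypothesis Mneq : forall e, e \in M -> e.1 != e.2.
Hypothesis Msize : forall e, e \in M -> size (J e) <= r.
Hypothesis MJU : forall e z, e \in M -> z \in J e -> z \notin U.
Hypothesis MJ : forall e e' z, e \in M -> e' \in M -> z \in J e -> z \in J e' -> e = e'.

Let X := U :|: [set z | [exists e in M, z \in J e]].
(** The inner vertices of a walk are contracted into its first endpoint. The fiber of a vertex of
    [U] is thus a union of walks starting there, each cut just before its last edge, and has radius
    at most [r]. *)
Let owner z := if z \in U then z else
  if [pick e in M | z \in J e] is Some e then e.1 else z.

Lemma ownerU z : z \in U -> owner z = z.
Proof. by rewrite /owner => ->. Qed.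

Lemma ownerJ e z : e \in M -> z \in J e -> owner z = e.1.
Proof.
move=> eM zJ; rewrite /owner (negbTE (MJU eM zJ)).
case: pickP => [e' /andP[e'M zJ']|/(_ e)]; last by rewrite eM zJ.
by rewrite (MJ e'M eM zJ' zJ).
Qed.

Lemma owner_in z : z \in X -> owner z \in U.
Proof.
rewrite !inE => /orP[zU|/existsP[e /andP[eM zJ]]]; first by rewrite ownerU.
by rewrite (ownerJ eM zJ); case: (MU eM).
Qed.

Lemma JX e z : e \in M -> z \in J e -> z \in X.
Proof. by move=> eM zJ; rewrite !inE; apply/orP; right; apply/existsP; exists e; rewrite eM. Qed.
Lemma UX z : z \in U -> z \in X. Proof. by move=> zU; rewrite inE zU. Qed.

Let SV : finType := {x | x \in X}.
Let HV : finType := {x | x \in U}.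

Let Sedge (u v : SV) := edge (val u) (val v).
Lemma Sedge_sym : symmetric Sedge. Proof. by move=> u v; apply: edge_sym. Qed.
Lemma Sedge_irrefl : irreflexive Sedge. Proof. by move=> u; apply: edge_irrefl. Qed.
Let Sgr := SGraph Sedge_sym Sedge_irrefl.

Let phi (z : SV) : HV := Sub (owner (val z)) (owner_in (valP z)).
Let Hedge (h h' : HV) := (h != h') &&
  [exists u : SV, exists v : SV, [&& phi u == h, phi v == h' & Sedge u v]].

Lemma Hedge_irrefl : irreflexive Hedge. Proof. by move=> h; rewrite /Hedge eqxx. Qed.

Lemma Hedge_sym : symmetric Hedge.
Proof.
move=> h h'; rewrite /Hedge eq_sym; congr (_ && _).
apply/existsP/existsP => -[u /existsP[v /and3P[E1 E2 E3]]]; exists v; apply/existsP; exists u;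
by rewrite E1 E2 /Sedge edge_sym.
Qed.

Let Hgr := SGraph Hedge_sym Hedge_irrefl.

Lemma fiber_path (h : HV) (c : SV) (s : seq G) :
  phi c = h -> path edge (val c) s ->
  (forall x, x \in s -> x \in X /\ owner x = val h) ->
  exists p : seq SV, [/\ path [rel x y : SV | [&& Sedge x y, phi x == h & phi y == h]] c p,
    val (last c p) = last (val c) s & size p = size s].
Proof.
elim: s c => [|x s IH] c pc; first by exists [::].
case/andP=> Ecx ps Hs.
have [xX xo] := Hs x (mem_head _ _).
have px : phi (Sub x xX) = h by apply: val_inj.
have [|p [P1 P2 P3]] := IH (Sub x xX) px ps.
  by move=> y ys; apply: Hs; rewrite inE ys orbT.
exists (Sub x xX :: p); split => //=; last by rewrite P3.
by rewrite P1 andbT /Sedge /= Ecx pc px eqxx.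
Qed.

Lemma contract_ok : subgraph Sgr G /\ contraction r Sgr Hgr.
Proof.
split; first by exists (fun x : Sgr => val (x : SV)); [apply: val_inj|].
exists phi; split; last first.
  move=> h h'; split.
    case/andP=> /eqP nh /existsP[u /existsP[v /and3P[/eqP E1 /eqP E2 E3]]].
    by split=> //; exists u, v.
  case=> /eqP nh [u [v [E1 E2 E3]]]; apply/andP; split=> //.
  by apply/existsP; exists u; apply/existsP; exists v; rewrite E1 E2 !eqxx.
move=> h.
have hX := UX (valP h); pose c : SV := Sub (val h) hX.
have pc : phi c = h by apply: val_inj; rewrite /= ownerU // (valP h).
exists c => // v pv.
have [vU|vU] := boolP (val v \in U).
  exists [::]; split=> //=; apply: val_inj => /=.
  by rewrite -pv /= ownerU.
have := valP v; rewrite inE (negbTE vU) inE /= => /existsP[e /andP[eM vJ]].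
have hv : val h = e.1 by rewrite -pv /= (ownerJ eM vJ).
have := Mpath eM; have := Msize eM.
have [p1 [p2 EJ]] : exists p1 p2, J e = rcons p1 (val v) ++ p2.
  by case/path.splitP: vJ => p1 p2; exists p1, p2.
rewrite EJ rcons_cat cat_path size_cat => sz /andP[pp _].
have [|||p [P1 P2 P3]] := @fiber_path h c (rcons p1 (val v)).
- exact: pc.
- by rewrite /= hv.
- move=> x xs; have xJ : x \in J e by rewrite EJ mem_cat xs.
  by rewrite (ownerJ eM xJ) hv (JX eM xJ).
exists p; split=> //; first by apply: val_inj; rewrite P2 last_rcons.
by rewrite P3; apply: leq_trans sz; apply: leq_addr.
Qed.

Lemma card_M : #|M| <= #|[set p : Hgr * Hgr | edge p.1 p.2]|.
Proof.
pose E := [set p : Hgr * Hgr | edge p.1 p.2].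
apply: leq_trans (leq_imset_card (fun p : Hgr * Hgr => (val (p.1 : HV), val (p.2 : HV))) _).
apply/subset_leq_card/subsetP => -[a b] eM.
have [/= aU bU] := MU eM.
apply/imsetP; exists (exist (fun x => x \in U) a aU : HV, exist (fun x => x \in U) b bU : HV) => //.
rewrite inE /=; apply/andP; split; first by have /= := Mneq eM; apply: contra => /eqP [->].
(* The last inner vertex, or [a] itself if the walk is a single edge, lies in the fiber of [a]; its
   edge to [b] becomes the arc of the minor. *)
have Hl : last a (J (a,b)) \in X /\ owner (last a (J (a,b))) = a.
  case/lastP EJ: (J (a,b)) => [|s x]; first by rewrite /= ownerU // UX.
  have xJ : x \in J (a,b) by rewrite EJ mem_rcons mem_head.
  by rewrite last_rcons (JX eM xJ) (ownerJ eM xJ).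
case: Hl => lX lo.
apply/existsP; exists (exist (fun x => x \in X) _ lX : SV); apply/existsP; exists (exist (fun x => x \in X) b (UX bU) : SV).
apply/and3P; split; [by apply/eqP/val_inj|by apply/eqP/val_inj; rewrite /= ownerU|].
by have := Mpath eM; rewrite rcons_path => /andP[].
Qed.

(** [M] consists of ordered pairs, so an edge of the minor may be counted twice: hence the factor
    2. *)
Lemma disjoint_paths_density (f : nat) :
  (forall S H, subgraph S G -> contraction r S H -> #|edges H| <= f * #|{: H}|) ->
  #|M| <= 2 * f * #|U|.
Proof.
case: contract_ok => H1 H2 /(_ _ _ H1 H2) Hf.
apply: leq_trans card_M _; apply: leq_trans (card_arcs_le Hgr) _.
rewrite -mulnA leq_mul2l /=; apply: leq_trans Hf _.
by rewrite leq_mul2l (_ : #|{: Hgr}| = #|U|) ?leqnn ?orbT // card_sig; apply: eq_card.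
Qed.
End Contract.

Lemma card_bigcup_le (I T : finType) (A : {set I}) (F : I -> {set T}) q :
  (forall i, i \in A -> #|F i| <= q) -> #|\bigcup_(i in A) F i| <= q * #|A|.
Proof.
move=> HF; rewrite mulnC -sum_nat_const.
elim/big_rec2: _ => [|i n S iA IH]; first by rewrite cards0.
by apply: leq_trans (leq_card_setU _ _) _; rewrite leq_add ?HF.
Qed.

(* The pairs whose walk meets [U] in an inner vertex are at most [q * #|U|]; among the
   others, a maximal set of walks with disjoint interiors contracts to a minor on [U]. *)
Lemma path_density (G : sgraph) (r q f : nat) (U : {set G}) (E : {set G * G})
    (J : G * G -> seq G) :
  (forall S H, subgraph S G -> contraction r S H -> #|edges H| <= f * #|{: H}|) ->
  (forall e, e \in E -> e.1 \in U /\ e.2 \in U) ->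
  (forall e, e \in E -> path edge e.1 (rcons (J e) e.2)) ->
  (forall e, e \in E -> e.1 != e.2) ->
  (forall e, e \in E -> size (J e) <= r) ->
  (forall z, #|[set e in E | z \in J e]| <= q) ->
  #|E| <= (q + (1 + q * r) * (2 * f)) * #|U|.
Proof.
move=> Hf EU Ep En Es Eq.
pose E0 := [set e in E | has (mem U) (J e)].
pose E1 := E :\: E0.
have c0 : #|E0| <= q * #|U|.
  apply: leq_trans (card_bigcup_le (F := fun z => [set e in E | z \in J e]) _) => //.
  apply/subset_leq_card/subsetP => e; rewrite inE => /andP[eE /hasP[z zJ zU]].
  by apply/bigcupP; exists z => //; rewrite inE eE.
have inE1 e : e \in E1 -> e \in E /\ forall z, z \in J e -> z \notin U.
  rewrite !inE negb_and; case: (e \in E) => //= /andP[/hasPn H _]; split=> // z; exact: H.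
pose ok (M : {set G * G}) := (M \subset E1) &&
  [forall e in M, forall e' in M, has (mem (J e)) (J e') ==> (e == e')].
have ok0 : ok set0.
  by rewrite /ok sub0set; apply/forall_inP => e; rewrite inE.
pose M := [arg max_(M > set0 | ok M) #|M|].
have [/andP[ME1 /forall_inP dM] maxM] : ok M /\ forall M', ok M' -> #|M'| <= #|M|.
  by rewrite /M; case: arg_maxnP.
have cM : #|M| <= 2 * f * #|U|.
  apply: (@disjoint_paths_density G r U M J _ _ _ _ _ _ f Hf) => e.
  - by move/(subsetP ME1)/inE1 => [/EU].
  - by move/(subsetP ME1)/inE1 => [/Ep].
  - by move/(subsetP ME1)/inE1 => [/En].
  - by move/(subsetP ME1)/inE1 => [/Es].
  - by move=> z /(subsetP ME1)/inE1 => [[_]]; apply.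
  move=> e' z eM e'M zJ zJ'; apply/eqP.
  have /forall_inP/(_ _ e'M)/implyP := dM _ eM; apply.
  by apply/hasP; exists z.
(* By maximality every remaining walk shares an inner vertex with a chosen one; a chosen walk has at
   most [r] of them, each lying on at most [q] walks. This is the origin of the factor
   [1 + q * r]. *)
have sub1 : E1 \subset M :|: \bigcup_(e in M) \bigcup_(z in [set z in J e]) [set e' in E | z \in J e'].
  apply/subsetP => e eE1; rewrite inE; have [//|eM /=] := boolP (e \in M).
  have [/existsP[e' /andP[e'M /hasP[z zJ zJ']]]|] := boolP [exists e' in M, has (mem (J e')) (J e)].
    apply/bigcupP; exists e' => //; apply/bigcupP; exists z; first by rewrite inE.
    by rewrite inE zJ; case: (inE1 _ eE1) => ->.
  rewrite negb_exists => /forallP Hno.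
  have: #|e |: M| <= #|M|; last by rewrite cardsU1 eM ltnn.
  apply: maxM; rewrite /ok subUset sub1set eE1 ME1 /=.
  have Hn e' : e' \in M -> has (mem (J e')) (J e) = false.
    by move=> e'M; have := Hno e'; rewrite e'M /= => /negbTE.
  have Hn' e' : e' \in M -> has (mem (J e)) (J e') = false.
    by move=> /Hn H; rewrite has_sym.
  apply/forall_inP => a /setU1P aM; apply/forall_inP => b /setU1P bM.
  case: aM bM => [->|aM] [->|bM]; rewrite ?eqxx ?implybT ?Hn ?Hn' //.
  by have /forall_inP/(_ _ bM) := dM _ aM.
have c1 : #|E1| <= #|M| + q * r * #|M|.
  apply: leq_trans (subset_leq_card sub1) _.
  apply: leq_trans (leq_card_setU _ _) _; rewrite leq_add2l.
  apply: card_bigcup_le => e /(subsetP ME1)/inE1 [eE _].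
  apply: leq_trans (card_bigcup_le (q := q) _) _ => [z _|]; first exact: Eq.
  rewrite leq_mul2l; apply/orP; right; apply: leq_trans (Es _ eE).
  by rewrite cardsE; apply: card_size.
have -> : #|E| = #|E0| + #|E1|.
  by rewrite -(cardsID E0 E) (setIidPr _) //; apply/subsetP => e; rewrite inE => /andP[].
rewrite mulnDl leq_add //; apply: leq_trans c1 _.
by rewrite -mulSn -mulnA leq_mul2l cM orbT.
Qed.

Lemma card_bigcup_sum (I T : finType) (P : pred I) (F : I -> {set T}) :
  #|\bigcup_(i | P i) F i| <= \sum_(i | P i) #|F i|.
Proof.
elim/big_rec2: _ => [|i n S iA IH]; first by rewrite cards0.
by apply: leq_trans (leq_card_setU _ _) _; rewrite leq_add2l.
Qed.

(** * Weighted arcs and hubs *)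

Section Levels.
Variable G : sgraph.

(* Letter [l] maps each vertex [v] to the head of its [l]-th arc, and to [v] when there is none. *)
Definition joined (wts : seq nat) (g : nat -> G -> G) s (a b : G) :=
  exists l, [/\ l < size wts, nth 0 wts l <= s & g l a = b \/ g l b = a].

(** The weights sum to exactly [s], so a choice of two letters is due at exactly one level.
    Requiring both ends to differ from [v] rules out absent arcs. *)
Definition fork (wts : seq nat) (g : nat -> G -> G) s (a b : G) :=
  exists l l' v, [/\ l < size wts, l' < size wts, nth 0 wts l + nth 0 wts l' = s &
    [/\ a = g l v, b = g l' v, a != v, b != v & a != b]].

Definition arc_count (g : nat -> G -> G) (I : G -> nat -> seq G) z l :=
  #|[set v | (g l v != v) && (z \in I v l)]|.

(** [I v l] lists the inner vertices of a walk realizing the [l]-th arc of [v]. The congestion [c]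
    is summed over all letters, so that it grows additively when letters are appended; it belongs to
    the invariant because it enters the density of the next level. *)
Record linv (d : nat) (wts : seq nat) (c : nat) (g : nat -> G -> G) : Prop := Linv {
  linv_paths : exists2 I : G -> nat -> seq G,
    forall l v, l < size wts -> g l v != v ->
      path edge v (rcons (I v l) (g l v)) /\ size (I v l) < nth 0 wts l &
    forall z, \sum_(0 <= l < size wts) arc_count g I z l <= c;
  linv_fork : forall s a b, s <= d -> fork wts g s a b -> joined wts g s a b;
  linv_edge : forall a b, 0 < d -> edge a b -> joined wts g 1 a b }.

(** The walk of a fork that passes through a given vertex either has it as the middle of the fork,
    once for each pair of letters, or passes through it inside one of its two arcs, the letter of
    the other arc being free. *)
Definition congestion (wts : seq nat) c := size wts * size wts + (size wts * c).*2.

(** The constant of [path_density] for radius [d] when at most [congestion wts c] walks pass through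
    each vertex. *)
Definition level_density (f : nat -> nat) d wts c :=
  congestion wts c + (1 + congestion wts c * d) * (2 * f d).

Lemma joined_leq wts g s s' a b : s <= s' -> joined wts g s a b -> joined wts g s' a b.
Proof. by move=> ss [l [l1 l2 l3]]; exists l; split=> //; apply: leq_trans ss. Qed.

Lemma joined_extend wts us g g' s a b : (forall l v, l < size wts -> g' l v = g l v) ->
  joined wts g s a b -> joined (wts ++ us) g' s a b.
Proof.
move=> g'old [l [l1 l2 l3]]; exists l.
by rewrite size_cat ltn_addr // nth_cat l1 !g'old.
Qed.

Lemma joined_new wts Dl s (g : nat -> G -> G) a b :
  (exists2 l, size wts <= l < size wts + Dl & g l a = b \/ g l b = a) ->
  joined (wts ++ nseq Dl s) g s a b.
Proof.
case=> l /andP[l1 l2] l3; exists l; rewrite size_cat size_nseq; split=> //.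
by rewrite nth_cat ltnNge l1 /= nth_nseq ltn_subLR // l2.
Qed.

Section Step.
Variables (d : nat) (wts : seq nat) (c : nat) (g : nat -> G -> G) (E : {set G * G}).
Hypothesis Hinv : linv d wts c g.
Hypothesis E_sound : forall a b, (a, b) \in E -> a != b /\ (edge a b \/ fork wts g d.+1 a b).

(** A fork with middle [v] yields the walk that runs back along one arc to [v] and out along the
    other. An arc of weight [s] has at most [s - 1] inner vertices; with [v] itself, a fork of
    weight [d.+1] has at most [d]. An edge has none. *)
Lemma level_paths : exists J : G * G -> seq G,
  [/\ forall e, e \in E -> path edge e.1 (rcons (J e) e.2),
      forall e, e \in E -> size (J e) <= d &
      forall z, #|[set e in E | z \in J e]| <= congestion wts c].
Proof.
have [I Ip Ic] := linv_paths Hinv.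
pose off := size wts.
pose K := ('I_off * 'I_off)%type.
pose good (e : G * G) (t : K * G) := [&& nth 0 wts t.1.1 + nth 0 wts t.1.2 == d.+1,
   e.1 == g t.1.1 t.2, e.2 == g t.1.2 t.2, e.1 != t.2 & e.2 != t.2].
pose J e := if edge e.1 e.2 then [::] else
  if [pick t | good e t] is Some t then rev (I t.2 t.1.1) ++ t.2 :: I t.2 t.1.2 else [::].
have pickE e : e \in E -> ~~ edge e.1 e.2 -> exists2 t, good e t &
    J e = rev (I t.2 t.1.1) ++ t.2 :: I t.2 t.1.2.
  case: e => a b /E_sound [nab [->//|[l [l' [v [ll ll' wl [ea eb av bv _]]]]]]] /negbTE nE.
  rewrite /J nE; case: pickP => [t gt|/(_ ((Ordinal ll, Ordinal ll'), v))]; first by exists t.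
  by rewrite /good /= wl -ea -eb !eqxx av bv.
exists J; split.
- move=> e eE; have [Ee|nE] := boolP (edge e.1 e.2); first by rewrite /J Ee /= Ee.
  have [[[l l'] v] /and5P[/= wl /eqP ea /eqP eb av bv] ->] := pickE _ eE nE.
  rewrite ea eb in av bv *.
  have [p1 _] := Ip _ _ (ltn_ord l) av; have [p2 _] := Ip _ _ (ltn_ord l') bv.
  rewrite rcons_cat cat_path /=.
  have := rev_path edge v (rcons (I v l) (g l v)).
  rewrite last_rcons belast_rcons rev_cons rcons_path => H.
  rewrite (eq_path (e' := edge)) in H; last by move=> x y; apply: edge_sym.
  by move: H; rewrite p1 => /andP[-> ->]; rewrite p2.
- move=> e eE; have [Ee|nE] := boolP (edge e.1 e.2); first by rewrite /J Ee.
  have [[[l l'] v] /and5P[/= /eqP wl /eqP ea /eqP eb av bv] ->] := pickE _ eE nE.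
  rewrite ea eb in av bv *.
  have [_ p1] := Ip _ _ (ltn_ord l) av; have [_ p2] := Ip _ _ (ltn_ord l') bv.
  rewrite size_cat size_rev /= addnS -ltnS -wl -addSn.
  by rewrite -addnS leq_add.
move=> z.
pose F (t : K) := [set v | (v == z) || [|| (g t.1 v != v) && (z \in I v t.1) |
   (g t.2 v != v) && (z \in I v t.2)]].
(* A pair is determined by two letters and the middle of its fork, so it suffices to count the
   possible middles. *)
apply: (@leq_trans #|\bigcup_(t : K) ((fun v => (g t.1 v, g t.2 v)) @: F t)|).
  apply/subset_leq_card/subsetP => e; rewrite inE => /andP[eE zJ].
  have nE : ~~ edge e.1 e.2 by apply/negP => Ee; rewrite /J Ee in zJ.
  have [[[l l'] v] /and5P[/= /eqP wl /eqP ea /eqP eb av bv] EJ] := pickE _ eE nE.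
  apply/bigcupP; exists (l, l') => //; apply/imsetP; exists v; last by case: (e) ea eb => /= ? ? -> ->.
  rewrite EJ mem_cat mem_rev inE /= in zJ; rewrite ea eb in av bv.
  by rewrite inE /= av bv /= (eq_sym v); case: (z == v) zJ => //=; rewrite orbT.
apply: leq_trans (card_bigcup_sum _ _) _.
apply: (@leq_trans (\sum_(t : K) (1 + (arc_count g I z t.1 + arc_count g I z t.2)))).
  apply: leq_sum => t _; apply: leq_trans (leq_imset_card _ _) _.
  apply: (@leq_trans #|[set z] :|: ([set v | (g t.1 v != v) && (z \in I v t.1)] :|: [set v | (g t.2 v != v) && (z \in I v t.2)])|).
    by apply/subset_leq_card/subsetP => v; rewrite !inE.
  apply: leq_trans (leq_card_setU _ _) _.
  by rewrite cards1 leq_add2l; apply: leq_card_setU.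
have Sc : \sum_(l < off) arc_count g I z l <= c by have := Ic z; rewrite big_mkord.
rewrite big_split /= sum1_card card_prod card_ord big_split /= leq_add2l -addnn.
rewrite -(pair_big xpredT xpredT (fun (l l' : 'I_off) => arc_count g I z l)) /=.
rewrite -(pair_big xpredT xpredT (fun (l l' : 'I_off) => arc_count g I z l')) /=.
apply: leq_add.
  rewrite exchange_big /= sum_nat_const card_ord leq_mul2l; by rewrite Sc orbT.
by rewrite sum_nat_const card_ord leq_mul2l Sc orbT.
Qed.

(** The bound is stated for every [U] because the orientation applies it to the vertices that still
    have high degree. *)
Lemma level_dense (f : nat -> nat) :
  (forall r S H, subgraph S G -> contraction r S H -> #|edges H| <= f r * #|{: H}|) ->
  forall U : {set G}, #|[set e in E | (e.1 \in U) && (e.2 \in U)]| <=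
    level_density f d.+1 wts c * #|U|.
Proof.
move=> Hf U; have [J [J1 J2 J3]] := level_paths.
apply: (@path_density G d.+1 _ _ U _ J (Hf d.+1)) => [e|e|[a b]|e|z].
- by rewrite inE => /and3P[].
- by rewrite inE => /andP[/J1].
- by rewrite inE => /andP[/E_sound[]].
- by rewrite inE => /andP[/J2 /leqW].
apply: leq_trans (J3 z); apply/subset_leq_card/subsetP => e.
by rewrite !inE -andbA => /and3P[-> _ ->].
Qed.

(** Appending letters creates no fork of weight at most [d.+1]: a new letter already weighs [d.+1]
    and the other letter of a fork has positive weight. At most [congestion wts c] walks of [E] pass
    through a given vertex, and each can start at either of its two ends, so every one of the [Dl]
    new letters adds at most [2 * congestion wts c]. *)
Lemma level_step Dl (g' : nat -> G -> G) :
  (forall a b, fork wts g d.+1 a b -> (a, b) \in E \/ joined wts g d.+1 a b) ->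
  (d = 0 -> forall a b, edge a b -> (a, b) \in E \/ joined wts g 1 a b) ->
  (forall l v, l < size wts -> g' l v = g l v) ->
  (forall l v, size wts <= l < size wts + Dl -> g' l v != v ->
     (v, g' l v) \in E \/ (g' l v, v) \in E) ->
  (forall a b, (a, b) \in E -> exists2 l, size wts <= l < size wts + Dl & g' l a = b \/ g' l b = a) ->
  linv d.+1 (wts ++ nseq Dl d.+1) (c + Dl * (2 * congestion wts c)) g'.
Proof.
move=> Cf Ce g'old g'new Ecov.
have [I Ip Ic] := linv_paths Hinv; have [J [J1 J2 J3]] := level_paths.
have sz : size (wts ++ nseq Dl d.+1) = size wts + Dl by rewrite size_cat size_nseq.
have nold l : l < size wts -> nth 0 (wts ++ nseq Dl d.+1) l = nth 0 wts l.
  by move=> ll; rewrite nth_cat ll.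
have nnew l : size wts <= l < size wts + Dl -> nth 0 (wts ++ nseq Dl d.+1) l = d.+1.
  by case/andP=> l1 l2; rewrite nth_cat ltnNge l1 /= nth_nseq ltn_subLR // l2.
have jold s a b : joined wts g s a b -> joined (wts ++ nseq Dl d.+1) g' s a b.
  exact: joined_extend.
have jE a b : (a, b) \in E -> joined (wts ++ nseq Dl d.+1) g' d.+1 a b.
  by move=> /Ecov; apply: joined_new.
split.
- pose I' v l := if l < size wts then I v l else
    if (v, g' l v) \in E then J (v, g' l v) else rev (J (g' l v, v)).
  exists I' => [l v|z].
    rewrite sz /I' => ll; case: ltnP => l1.
      by rewrite nold // g'old //; apply: Ip.
    move=> /(g'new l v) H; rewrite nnew ?l1 //; case: ifP => [/[dup] /J1 /= -> /J2 //|nE].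
    have {H} eE : (g' l v, v) \in E by case: H => //; rewrite ?l1 // nE.
    rewrite size_rev ltnS (J2 _ eE); split => //.
    have := rev_path edge (g' l v) (rcons (J (g' l v, v)) v).
    rewrite last_rcons belast_rcons rev_cons => ->.
    by rewrite (eq_path (e' := edge)) ?(J1 _ eE) // => x y; apply: edge_sym.
  rewrite sz (big_cat_nat (n := size wts)) ?leq_addr //=; apply: leq_add.
    apply: leq_trans (Ic z); rewrite !big_nat; apply: leq_sum => l /andP[_ ll].
    by apply/subset_leq_card/subsetP => v; rewrite !inE /I' ll g'old.
  rewrite -[in X in X * _](addKn (size wts) Dl) -sum_nat_const_nat !big_nat.
  apply: leq_sum => l l1.
  pose Ez := [set e in E | z \in J e].
  apply: (@leq_trans #|(fst @: Ez) :|: (snd @: Ez)|).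
    apply/subset_leq_card/subsetP => v; rewrite !inE => /andP[av].
    rewrite /I' ltnNge (andP l1).1 /=; have := g'new l v l1 av.
    case: ifP => [eE _ zJ|_ [//|eE]]; last rewrite mem_rev => zJ; apply/orP.
      by left; apply/imsetP; exists (v, g' l v) => //; rewrite inE eE.
    by right; apply/imsetP; exists (g' l v, v) => //; rewrite inE eE.
  apply: leq_trans (leq_card_setU _ _) _; rewrite mul2n -addnn.
  by apply: leq_add; apply: leq_trans (leq_imset_card _ _) (J3 z).
- move=> s a b sd [l [l' [v [l1 l2 ws [ea eb av bv ab]]]]].
  rewrite sz in l1 l2.
  have pos k x : k < size wts + Dl -> x = g' k v -> x != v -> 0 < nth 0 (wts ++ nseq Dl d.+1) k.
    move=> kk -> xv; have [k1|k1] := ltnP k (size wts); last by rewrite nnew ?k1.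
    rewrite nold // in xv *; rewrite g'old // in xv.
    by have [_] := Ip _ _ k1 xv; apply: leq_ltn_trans.
  have p1 := pos _ _ l1 ea av; have p2 := pos _ _ l2 eb bv.
  have o1 : l < size wts.
    rewrite ltnNge; apply/negP => k1; move: ws sd; rewrite nnew ?k1 // => <-.
    by rewrite leqNgt -[X in X < _]addn0 ltn_add2l p2.
  have o2 : l' < size wts.
    rewrite ltnNge; apply/negP => k1; move: ws sd; rewrite addnC nnew ?k1 // => <-.
    by rewrite leqNgt -[X in X < _]addn0 ltn_add2l p1.
  have fk : fork wts g s a b.
    by exists l, l', v; rewrite -!nold // -!g'old.
  move: sd; rewrite leq_eqVlt => /orP[/eqP sd|sd]; last first.
    by apply/jold/(linv_fork Hinv) => //.
  by rewrite sd in fk *; case: (Cf _ _ fk) => [/jE|/jold].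
- move=> a b _ ab; case: (posnP d) => [d0|dp].
    by case: (Ce d0 _ _ ab) => [/jE|/jold //]; rewrite d0.
  by apply/jold/(linv_edge Hinv).
Qed.
End Step.
End Levels.

Section Dist.
Variable G : sgraph.

Lemma dist_le_trans a b (u v w : G) :
  dist_le edge a u v -> dist_le edge b v w -> dist_le edge (a + b) u w.
Proof.
case=> p [p1 p2 p3] [q [q1 q2 q3]]; exists (p ++ q).
by rewrite cat_path p1 last_cat p2 q1 size_cat leq_add.
Qed.

Lemma dist_le_sym a (u v : G) : dist_le edge a u v -> dist_le edge a v u.
Proof.
case=> p [p1 p2 p3]; exists (rev (belast u p)); split.
- rewrite -p2 rev_path (eq_path (e' := edge)) // => x y; exact: edge_sym.
- by case: p p1 p2 p3 => //= x p _ _ _; rewrite rev_cons last_rcons.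
by rewrite size_rev size_belast.
Qed.

Lemma dist_le_leq a b (u v : G) : a <= b -> dist_le edge a u v -> dist_le edge b u v.
Proof. by move=> ab [p [p1 p2 p3]]; exists p; split=> //; apply: leq_trans ab. Qed.

Lemma dist_le0 d (u : G) : dist_le edge d u u.
Proof. by exists [::]. Qed.
End Dist.

(** * Common hubs of vertices at bounded distance *)

Section Hubs.
Variables (G : sgraph) (m : nat) (wts : seq nat) (c : nat) (g : nat -> G -> G).
Hypothesis Hinv : linv m wts c g.

Definition hub (g : nat -> G -> G) (w : seq nat) (u : G) := foldl (fun x l => g l x) u w.
Definition wlen (wts w : seq nat) := sumn [seq nth 0 wts l | l <- w].
Definition word (wts w : seq nat) := all (fun l => l < size wts) w.

Lemma hub_dist w u : word wts w -> dist_le edge (wlen wts w) u (hub g w u).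
Proof.
elim: w u => [|l w IH] u; first by move=> _; apply: dist_le0.
case/andP=> ll /(IH (g l u)); apply: dist_le_trans.
have [->|gu] := eqVneq (g l u) u; first exact: dist_le0.
have [I Ip _] := linv_paths Hinv; have [p1 p2] := Ip _ _ ll gu.
by exists (rcons (I u l) (g l u)); rewrite p1 last_rcons size_rcons.
Qed.

(** If the joining arc leaves [u], it is put in front of [w]. If it enters [u], then [x] has two
    outgoing arcs, to [u] and along the first letter of [w], and [linv_fork] replaces both by one
    arc between their heads of no larger weight. So [w] is consumed until some arc leaves [u] or [w]
    is empty; in the latter case the arc from [x] to [u] is appended to [w'] and [u] itself is the
    hub. *)
Lemma hub_prepend w : forall s u x v w', joined wts g s u x -> word wts w -> word wts w' ->
  s + wlen wts w + wlen wts w' <= m -> hub g w x = hub g w' v ->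
  exists w1 w2, [/\ word wts w1, word wts w2, hub g w1 u = hub g w2 v &
    wlen wts w1 + wlen wts w2 <= s + wlen wts w + wlen wts w'].
Proof.
elim: w => [|k w IH] s u x v w' [l [ll ls [gux|gxu]]] ww ww' le E.
- by exists [:: l], w'; rewrite -E /= ll /hub /= gux; split=> //; rewrite leq_add2r leq_add2r.
- exists [::], (rcons w' l); split=> //=.
  + by rewrite /word all_rcons ll.
  + by rewrite /hub -cats1 foldl_cat /= -gxu; move: E; rewrite /hub /= => <-.
  by rewrite /wlen map_rcons sumn_rcons add0n addn0 addnC leq_add2r.
- exists [:: l, k & w], w'; rewrite -E /= ll /hub /= gux; split=> //.
  by rewrite !leq_add2r.
case/andP: ww => lk ww.
(* A fork needs three distinct vertices. Each of the three coincidences allows a letter or an arc to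
   be dropped. *)
have [ux|ux] := eqVneq u x.
  exists (k :: w), w'; rewrite /= lk ux; split=> //; by rewrite leq_add2r leq_addl.
have [yx|yx] := eqVneq (g k x) x.
  have [|||w1 [w2 [a1 a2 a3 a4]]] := IH s u x v w' _ ww ww'.
  - by exists l; split=> //; right.
  - by apply: leq_trans le; rewrite leq_add2r leq_add2l leq_addl.
  - by rewrite -[in LHS]yx.
  exists w1, w2; split=> //; apply: leq_trans a4 _.
  by rewrite leq_add2r leq_add2l leq_addl.
have [uy|uy] := eqVneq u (g k x).
  exists w, w'; rewrite uy; split=> //.
  by rewrite leq_add2r /wlen /= addnA leq_addl.
have J : joined wts g (nth 0 wts l + nth 0 wts k) u (g k x).
  apply: (linv_fork Hinv).
    apply: leq_trans le; by rewrite /wlen /= -!addnA leq_add ?leq_addr.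
  by exists l, k, x; rewrite gxu.
have le' : nth 0 wts l + nth 0 wts k + wlen wts w + wlen wts w' <= s + wlen wts (k :: w) + wlen wts w'.
  by rewrite /wlen /= leq_add2r -addnA leq_add2r.
have [|//|w1 [w2 [a1 a2 a3 a4]]] := IH _ _ _ v w' J ww ww'; first exact: leq_trans le' le.
by exists w1, w2; split=> //; apply: leq_trans a4 le'.
Qed.

(** Edges are arcs of weight 1 in one direction or the other, so the edges of a shortest enough path
    are prepended one at a time, starting from the trivial hub [v]. *)
Lemma common_hub u v d : d <= m -> dist_le edge d u v ->
  exists w1 w2, [/\ word wts w1, word wts w2, hub g w1 u = hub g w2 v &
    wlen wts w1 + wlen wts w2 <= d].
Proof.
move=> dm [p [p1 <- p3]].
suff: exists w1 w2, [/\ word wts w1, word wts w2, hub g w1 u = hub g w2 (last u p) &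
    wlen wts w1 + wlen wts w2 <= size p].
  by case=> w1 [w2 [a1 a2 a3 a4]]; exists w1, w2; split=> //; apply: leq_trans p3.
have {p3 dm} : size p <= m by apply: leq_trans dm.
elim: p u p1 => [|x p IH] u; first by exists [::], [::].
case/andP=> ux px pm; have [w1 [w2 [a1 a2 a3 a4]]] := IH x px (ltnW pm).
have J : joined wts g 1 u x by apply: (linv_edge Hinv) => //; apply: leq_trans pm.
have [|w3 [w4 [b1 b2 b3 b4]]] := hub_prepend J a1 a2 _ a3.
  by rewrite -addnA; apply: leq_trans pm; rewrite add1n ltnS.
exists w3, w4; split=> //; apply: leq_trans b4 _.
by rewrite -addnA add1n ltnS.
Qed.
End Hubs.

Fixpoint words_upto (L r : nat) : seq (seq nat) :=
  if r is r'.+1 then [::] :: [seq l :: w | l <- iota 0 L, w <- words_upto L r'] else [:: [::]].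

Definition words (wts : seq nat) r :=
  [seq w <- words_upto (size wts) r | word wts w && (wlen wts w <= r)].

(** As weights are positive, a word of weight at most [r] has at most [r] letters and is therefore
    enumerated. *)
Lemma mem_words wts r w : all (leq 1) wts ->
  (w \in words wts r) = word wts w && (wlen wts w <= r).
Proof.
move=> pos; rewrite mem_filter; case: (boolP (word wts w && (wlen wts w <= r))) => //= /andP[ww wr].
have {wr} : size w <= r.
  apply: leq_trans wr; elim: w ww => //= l w IH /andP[ll /IH H].
  by rewrite /wlen /= -add1n leq_add //; apply: (allP pos); apply: mem_nth.
elim: r w ww => [|r IH] [|l w] //= /andP[ll /IH H] /H H'.
by rewrite inE /=; apply/allpairsP; exists (l, w); rewrite mem_iota.
Qed.

Lemma card_pos_le (T : finType) (Q X : {set T}) (F : T -> nat) :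
  X \subset Q -> (forall u, u \in X -> 0 < F u) -> #|X| <= \sum_(u in Q) F u.
Proof.
move=> XQ HF; rewrite (big_setID X) (setIidPr XQ) /= -sum1_card.
by apply: leq_trans (leq_addr _ _); apply: leq_sum.
Qed.

(** * From owners and conflicts to the ratio of the two sets *)

Section Final.
Variables (G : sgraph) (k : nat) (wts : seq nat) (c0 : nat) (g : nat -> G -> G).
Hypothesis Hinv : linv (2 * k + 1) wts c0 g.
Hypothesis pos : all (leq 1) wts.
Variables (own : G -> option G) (P A : {set G}).
Notation Wk := (words wts k).
Notation Wm := (words wts (2 * k + 1)).
Hypothesis ownP : forall x v, own x = Some v -> v \in P /\ exists2 w, w \in Wk & hub g w v = x.
Hypothesis own_hub : forall v w, v \in P -> w \in Wk -> own (hub g w v) = Some v.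
Hypothesis nP : forall v, v \notin P -> exists2 w, w \in Wk & own (hub g w v) != None.

(** Conflicts are counted once per word, as the counting program does. *)
Definition conflicts (own : G -> option G) (W : seq (seq nat)) u v :=
  count (fun w => own (hub g w u) == Some v) W.
Definition indeg (own : G -> option G) (W : seq (seq nat)) (P : {set G}) v :=
  \sum_(u in P) conflicts own W u v.

Lemma own_dominating : k_dominating k [set x | own x != None].
Proof.
have key v w : w \in Wk -> own (hub g w v) != None ->
  exists2 u : G, u \in [set x | own x != None] & dist_le edge k u v.
  rewrite mem_words // => /andP[ww wl] Ho; exists (hub g w v); first by rewrite inE.
  by apply/dist_le_sym/(dist_le_leq wl)/(hub_dist Hinv).
move=> v; have [vP|/nP[w wW Ho]] := boolP (v \in P); last exact: key wW Ho.
have w0 : [::] \in Wk by rewrite mem_words.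
by apply: (key v [::]) => //; rewrite own_hub.
Qed.

Lemma card_own : #|[set x | own x != None]| <= size Wk * #|P|.
Proof.
apply: (@leq_trans #|\bigcup_(v in P) [set x in [seq hub g w v | w <- Wk]]|).
  apply/subset_leq_card/subsetP => x; rewrite inE; case Ho: (own x) => [v|] // _.
  have [vP [w wW <-]] := ownP Ho; apply/bigcupP; exists v => //.
  by rewrite inE; apply: map_f.
apply: card_bigcup_le => v _; rewrite cardsE; apply: leq_trans (card_size _) _.
by rewrite size_map.
Qed.

(** The two words to a common hub have total weight at most [2 * k + 1], so one of them has weight
    at most [k]. Its start owns the hub, and the other vertex reaches it by a word in [Wm]; the
    disjunction reflects that either word may be the short one. *)
Lemma near_conflict u v : u \in P -> v \in P -> dist_le edge (2 * k + 1) u v ->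
  (0 < conflicts own Wm u v) || (0 < conflicts own Wm v u).
Proof.
move=> uP vP /(common_hub Hinv (leqnn _)) [w1 [w2 [a1 a2 a3 a4]]].
rewrite -!has_count.
have wm w w' : word wts w -> wlen wts w + wlen wts w' <= 2 * k + 1 -> w \in Wm.
  by move=> ww wl; rewrite mem_words // ww; apply: leq_trans wl; apply: leq_addr.
have [wk|wk] := leqP (wlen wts w2) k; apply/orP.
  left; apply/hasP; exists w1; first exact: wm a4.
  by rewrite a3 own_hub // mem_words // a2.
right; apply/hasP; exists w2; first by apply: wm a2 _; rewrite addnC; exact: a4.
rewrite -a3 own_hub // mem_words // a1 /=.
rewrite -(leq_add2r k.+1); apply: leq_trans (leq_trans a4 _); first by rewrite leq_add2l.
by rewrite mul2n -addnn addn1 addnS.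
Qed.

Lemma sum_conflicts u (Q : {set G}) W : \sum_(v in Q) conflicts own W u v <= size W.
Proof.
rewrite /conflicts; elim: W => [|w W IH] /=; first by rewrite big1.
rewrite big_split /= -add1n leq_add //.
case: (own _) => [x|]; last by rewrite big1.
apply: (@leq_trans (\sum_v (v == x))).
  rewrite [X in _ <= X](bigID (mem Q)) /=; apply: leq_trans (leq_addr _ _).
  by apply: leq_sum => v _; rewrite (inj_eq Some_inj) eq_sym.
by rewrite (bigD1 x) //= eqxx big1 // => v /negbTE ->.
Qed.

(** Markov's inequality: every owner causes at most [size Wm] conflicts, so the average in-degree is
    at most [size Wm], and at most half of the owners exceed twice this value. *)
Lemma card_kept :
  #|P| <= 2 * #|[set v in P | indeg own Wm P v <= 2 * size Wm]|.
Proof.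
set B := [set v in P | _].
have S : \sum_(v in P) indeg own Wm P v <= #|P| * size Wm.
  rewrite /indeg exchange_big /= -sum_nat_const; apply: leq_sum => u _.
  exact: sum_conflicts.
have S2 : #|P :\: B| * (2 * size Wm).+1 <= #|P| * size Wm.
  apply: leq_trans S; rewrite -sum_nat_const.
  rewrite [X in _ <= X](big_setID B) /=; apply: leq_trans (leq_addl _ _).
  by apply: leq_sum => v; rewrite !inE negb_and => /andP[/orP[/negP|] + vP //]; rewrite -ltnNge.
have BP : B \subset P by apply/subsetP => v; rewrite inE => /andP[].
have := cardsID B P; rewrite (setIidPr BP) => HP.
suff : #|P :\: B| <= #|B| by move=> le; rewrite -HP mul2n -addnn leq_add2l.
have H2 : 2 * #|P :\: B| <= #|P|.
  case: (posnP (size Wm)) S2 => [->|W0 S2].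
    by rewrite !muln0 muln1 leqn0 => /eqP ->.
  rewrite -(leq_pmul2r W0); apply: leq_trans S2.
  by rewrite mulnAC mulnC mulnS leq_addl.
by move: H2; rewrite -HP mul2n -addnn leq_add2r.
Qed.

Hypothesis AP : A \subset [set v in P | indeg own Wm P v <= 2 * size Wm].
Hypothesis Aindep : forall u v, u \in A -> v \in A -> u != v -> conflicts own Wm u v = 0.
Hypothesis Amax : forall u, u \in P -> indeg own Wm P u <= 2 * size Wm -> u \notin A ->
  exists2 v, v \in A & (0 < conflicts own Wm u v) || (0 < conflicts own Wm v u).

Lemma A_independent : d_independent (2 * k + 1) A.
Proof.
have AP' u : u \in A -> u \in P by move/(subsetP AP); rewrite inE => /andP[].
move=> u v uA vA uv /(near_conflict (AP' _ uA) (AP' _ vA)).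
by rewrite !Aindep // eq_sym.
Qed.

(** A vertex of [A] accounts for itself, for at most [2 * size Wm] owners in conflict towards it, as
    it is kept, and for at most [size Wm] towards which it is in conflict: hence [1 + 3 * size Wm].
    By maximality this exhausts the kept owners. The factor 2 comes from [card_kept], and [size Wk]
    bounds the hubs of one owner. *)
Lemma card_own_A :
  #|[set x | own x != None]| <= size Wk * (2 * (1 + 3 * size Wm)) * #|A|.
Proof.
apply: leq_trans card_own _; rewrite -mulnA leq_mul2l; apply/orP; right.
apply: leq_trans card_kept _; rewrite -mulnA leq_mul2l /=.
set B := [set v in P | _].
apply: (@leq_trans #|\bigcup_(v in A) ([set v] :|: ([set u in B | 0 < conflicts own Wm u v]
    :|: [set u in B | 0 < conflicts own Wm v u]))|).
  apply/subset_leq_card/subsetP => u uB; apply/bigcupP.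
  have [uA|uA] := boolP (u \in A); first by exists u => //; rewrite !inE eqxx.
  have := uB; rewrite inE => /andP[uP uI].
  have [v vA Hv] := Amax uP uI uA; exists v => //.
  by rewrite !inE uP uI /= Hv orbT.
apply: card_bigcup_le => v vA.
apply: leq_trans (leq_card_setU _ _) _; rewrite cards1 leq_add2l.
apply: leq_trans (leq_card_setU _ _) _; rewrite (mulnDl 2 1) mul1n leq_add //.
  have := subsetP AP _ vA; rewrite inE => /andP[_]; apply: leq_trans.
  apply: card_pos_le => [|u]; last by rewrite inE => /andP[].
  by apply/subsetP => u; rewrite !inE -andbA => /andP[].
apply: leq_trans (sum_conflicts v P _).
apply: card_pos_le => [|u]; last by rewrite inE => /andP[].
by apply/subsetP => u; rewrite !inE -andbA => /andP[].
Qed.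
End Final.

(** * Reasoning about programs *)

(** The word bound is set aside during the time analysis; [tame_exec] recovers it from the running
    time. *)
Definition run c s t s' := exists W, exec W c s t s'.

Lemma fits_mono W W' s e : W <= W' -> fits W s e -> fits W' s e.
Proof.
move=> WW; elim: e => [k|x|a e IH|e1 IH1 e2 IH2|e1 IH1 e2 IH2] /=;
  rewrite ?andbT; try exact: (fun H => leq_trans H WW).
- by case/andP=> H /IH ->; rewrite (leq_trans H WW).
- by case/and3P=> H /IH1 -> /IH2 ->; rewrite (leq_trans H WW).
- by case/and3P=> H /IH1 -> /IH2 ->; rewrite (leq_trans H WW).
Qed.

Lemma exec_mono W W' c s t s' : W <= W' -> exec W c s t s' -> exec W' c s t s'.
Proof.
move=> WW; elim=> {c s t s'} *; econstructor; eauto; exact: fits_mono WW _.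
Qed.

Lemma fits_exists s e : exists W, fits W s e.
Proof.
elim: e => [k|x|a e [W IH]|e1 [W1 IH1] e2 [W2 IH2]|e1 [W1 IH1] e2 [W2 IH2]] /=.
- by exists k; rewrite leqnn.
- by exists (var s x); rewrite leqnn.
- exists (maxn (arr s a (eval s e)) W); rewrite leq_maxl /=.
  exact: fits_mono (leq_maxr _ _) IH.
- exists (maxn (eval s e1 + eval s e2) (maxn W1 W2)); rewrite leq_maxl /=.
  by apply/andP; split; [apply: fits_mono IH1|apply: fits_mono IH2]; rewrite !leq_max leqnn ?orbT.
- exists (maxn (eval s e1 - eval s e2) (maxn W1 W2)); rewrite leq_maxl /=.
  by apply/andP; split; [apply: fits_mono IH1|apply: fits_mono IH2]; rewrite !leq_max leqnn ?orbT.
Qed.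

Lemma run_seq c1 c2 s1 s2 s3 t1 t2 :
  run c1 s1 t1 s2 -> run c2 s2 t2 s3 -> run (Seq c1 c2) s1 (t1 + t2).+1 s3.
Proof.
case=> W1 E1 [W2 E2]; exists (maxn W1 W2); apply: ExecSeq.
  exact: exec_mono (leq_maxl _ _) E1.
exact: exec_mono (leq_maxr _ _) E2.
Qed.

Lemma run_if e c1 c2 s t s' :
  run (if eval s e != 0 then c1 else c2) s t s' -> run (If e c1 c2) s (ecost e + t).+1 s'.
Proof.
case=> W1 E1; have [W2 F] := fits_exists s e; exists (maxn W1 W2).
have {}F := fits_mono (leq_maxr W1 W2) F; have {}E1 := exec_mono (leq_maxl W1 W2) E1.
by case: eqP E1 => [/eqP e0|/eqP e0] E1; [apply: ExecIfF|apply: ExecIfT].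
Qed.

Lemma run_while e c s1 s2 s3 t1 t2 : eval s1 e != 0 ->
  run c s1 t1 s2 -> run (While e c) s2 t2 s3 ->
  run (While e c) s1 (ecost e + t1 + t2).+1 s3.
Proof.
move=> e0 [W1 E1] [W2 E2]; have [W3 F] := fits_exists s1 e.
exists (maxn W3 (maxn W1 W2)); apply: ExecWhileT => //.
- exact: fits_mono (leq_maxl _ _) F.
- by apply: exec_mono E1; rewrite !leq_max leqnn ?orbT.
by apply: exec_mono E2; rewrite !leq_max leqnn ?orbT.
Qed.

Lemma run_while0 e c s : eval s e == 0 -> run (While e c) s (ecost e).+1 s.
Proof. by move=> e0; have [W F] := fits_exists s e; exists W; apply: ExecWhileF. Qed.

Fixpoint loop_free c :=
  match c with
  | Seq c1 c2 | If _ c1 c2 => loop_free c1 && loop_free c2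
  | While _ _ => false
  | _ => true
  end.

Fixpoint den c s :=
  match c with
  | Assign x e => set_var s x (eval s e)
  | Put a i e => set_arr s a (eval s i) (eval s e)
  | Seq c1 c2 => den c2 (den c1 s)
  | If e c1 c2 => if eval s e != 0 then den c1 s else den c2 s
  | _ => s
  end.

(** Only an upper bound: a conditional is charged both branches. *)
Fixpoint bcost c :=
  match c with
  | Skip => 1
  | Assign _ e => (ecost e).+1
  | Put _ i e => (ecost i + ecost e).+1
  | Seq c1 c2 => (bcost c1 + bcost c2).+1
  | If e c1 c2 => (ecost e + (bcost c1 + bcost c2)).+1
  | While _ _ => 0
  end.

Definition wp c s T (Q : state -> Prop) := exists t s', [/\ run c s t s', t <= T & Q s'].

Lemma run_den c s : loop_free c -> exists2 t, t <= bcost c & run c s t (den c s).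
Proof.
elim: c s => //= [s _|x e s _|a i e s _|c1 IH1 c2 IH2 s /andP[l1 l2]|e c1 IH1 c2 IH2 s /andP[l1 l2]].
- by exists 1 => //; exists 0; constructor.
- have [W F] := fits_exists s e; exists (ecost e).+1 => //.
  by exists W; constructor.
- have [W1 F1] := fits_exists s i; have [W2 F2] := fits_exists s e.
  exists (ecost i + ecost e).+1 => //.
  exists (maxn W1 W2); constructor; [apply: fits_mono F1|apply: fits_mono F2].
    exact: leq_maxl.
  exact: leq_maxr.
- have [t1 H1 E1] := IH1 s l1; have [t2 H2 E2] := IH2 (den c1 s) l2.
  exists (t1 + t2).+1; last exact: run_seq E1 E2.
  by rewrite ltnS leq_add.
case: (boolP (eval s e != 0)) => e0.
  have [t H E] := IH1 s l1; exists (ecost e + t).+1; last by apply: run_if; rewrite e0.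
  by rewrite ltnS leq_add2l (leq_trans H) // leq_addr.
have [t H E] := IH2 s l2; exists (ecost e + t).+1; last by apply: run_if; rewrite (negbTE e0).
by rewrite ltnS leq_add2l (leq_trans H) // leq_addl.
Qed.

Lemma wp_den c s (Q : state -> Prop) : loop_free c -> Q (den c s) -> wp c s (bcost c) Q.
Proof. by move=> /(run_den s) [t H E] q; exists t, (den c s). Qed.

Lemma wp_weaken c s T T' (Q Q' : state -> Prop) :
  wp c s T Q -> T <= T' -> (forall s', Q s' -> Q' s') -> wp c s T' Q'.
Proof.
case=> t [s' [E tT q]] TT QQ; exists t, s'; split=> //; first exact: leq_trans TT.
exact: QQ.
Qed.

Lemma wp_seq c1 c2 s T1 T2 (Q R : state -> Prop) :
  wp c1 s T1 R -> (forall s', R s' -> wp c2 s' T2 Q) -> wp (Seq c1 c2) s (T1 + T2).+1 Q.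
Proof.
case=> t1 [s1 [E1 H1 r]] H; have [t2 [s2 [E2 H2 q]]] := H s1 r.
exists (t1 + t2).+1, s2; split=> //; first exact: run_seq E1 E2.
by rewrite ltnS leq_add.
Qed.

Lemma wp_assign_seq x e c s T Q :
  wp c (set_var s x (eval s e)) T Q -> wp (Seq (Assign x e) c) s (ecost e + T).+2 Q.
Proof.
move=> H; rewrite -addSn; apply: (wp_seq (R := eq (set_var s x (eval s e)))).
  exact: (wp_den (c := Assign x e)).
by move=> _ <-.
Qed.

(** The index of [Inv] is a budget of iterations, which the loop need not exhaust. *)
Lemma wp_while e c (Inv : nat -> state -> Prop) : loop_free c ->
  (forall m s, Inv m s -> eval s e != 0 -> exists2 m', m = m'.+1 & Inv m' (den c s)) ->
  forall m s, Inv m s ->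
  wp (While e c) s (m.+1 * (ecost e + bcost c).+1) (fun s' => eval s' e = 0 /\ exists m', Inv m' s').
Proof.
move=> lf step; elim=> [|m IH] s Im; have [e0|e0] := boolP (eval s e == 0).
- exists (ecost e).+1, s; split; [exact: run_while0| |by split; [apply/eqP|exists 0]].
  by rewrite mul1n ltnS leq_addr.
- by have [] := step _ _ Im e0.
- exists (ecost e).+1, s; split; [exact: run_while0| |by split; [apply/eqP|exists m.+1]].
  by rewrite mulSn (leq_trans _ (leq_addr _ _)) // ltnS leq_addr.
have [m' [<-] Im'] := step _ _ Im e0.
have [t1 H1 E1] := run_den s lf; have [t2 [s2 [E2 H2 Q]]] := IH _ Im'.
exists (ecost e + t1 + t2).+1, s2; split=> //; first exact: run_while E1 E2.
by rewrite mulSn -addSn leq_add // ltnS leq_add2l.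
Qed.

Definition For x c := Seq (Assign x (Const 0))
  (While (Defs.Sub (Var 0) (Var x)) (Seq c (Assign x (Add (Var x) (Const 1))))).

Fixpoint wvars c :=
  match c with
  | Assign x _ => [:: x]
  | Seq c1 c2 | If _ c1 c2 => wvars c1 ++ wvars c2
  | While _ c => wvars c
  | _ => [::]
  end.

Fixpoint warrs c :=
  match c with
  | Put a _ _ => [:: a]
  | Seq c1 c2 | If _ c1 c2 => warrs c1 ++ warrs c2
  | While _ c => warrs c
  | _ => [::]
  end.

Definition frame c s s' :=
  (forall x, x \notin wvars c -> var s' x = var s x) /\
  (forall a, a \notin warrs c -> arr s' a = arr s a).

Lemma run_frame c s t s' : run c s t s' -> frame c s s'.
Proof.
case=> W; elim=> {c s t s'} //=.
- by move=> s x e _; split=> //= y; rewrite inE /upd => /negbTE ->.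
- by move=> s a i e _ _; split=> //= y; rewrite inE /upd => /negbTE ->.
- move=> s1 s2 s3 c1 c2 t1 t2 _ [v1 a1] _ [v2 a2]; split=> x /=; rewrite mem_cat negb_or => /andP[H1 H2].
    by rewrite v2 ?v1.
  by rewrite a2 ?a1.
- move=> s s' e c1 c2 t _ _ _ [v1 a1]; split=> x /=; rewrite mem_cat negb_or => /andP[H1 H2].
    by rewrite v1.
  by rewrite a1.
- move=> s s' e c1 c2 t _ _ _ [v1 a1]; split=> x /=; rewrite mem_cat negb_or => /andP[H1 H2].
    by rewrite v1.
  by rewrite a1.
move=> s1 s2 s3 e c t1 t2 _ _ _ [v1 a1] _ [v2 a2]; split=> x /= H.
  by rewrite v2 ?v1.
by rewrite a2 ?a1.
Qed.

Lemma den_frame c s : loop_free c -> frame c s (den c s).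
Proof. by move=> /(run_den s) [t _]; apply: run_frame. Qed.

Lemma wp_frame c s T (Q : state -> Prop) : wp c s T Q -> wp c s T (fun s' => Q s' /\ frame c s s').
Proof. by case=> t [s' [E H q]]; exists t, s'; split=> //; split=> //; apply: run_frame E. Qed.

(** The body may assume that the state differs from the initial one only where the loop writes, so
    [Inv] has to describe just the written cells. *)
Lemma wp_for x c (n : nat) (Inv : nat -> state -> Prop) s :
  loop_free c -> x \notin 0 :: wvars c -> 0 \notin wvars c -> var s 0 = n ->
  Inv 0 (set_var s x 0) ->
  (forall i s', i < n -> frame (For x c) s s' -> var s' x = i -> Inv i s' ->
     Inv i.+1 (set_var (den c s') x i.+1)) ->
  wp (For x c) s (n.+1 * (bcost c + 10)).*2 (Inv n).
Proof.
move=> lf xc c0 vn I0 step.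
rewrite inE negb_or in xc; case/andP: xc => x0 xc.
pose I m s' := [/\ m + var s' x = n, frame (For x c) s s' & Inv (var s' x) s'].
pose e := Defs.Sub (Var 0) (Var x); pose b := Seq c (Assign x (Add (Var x) (Const 1))).
have F0 : frame (For x c) s (set_var s x 0).
  by split=> //= y; rewrite inE negb_or /upd => /andP[/negbTE ->].
have H : wp (While e b) (set_var s x 0) (n.+1 * (ecost e + bcost b).+1)
    (fun s' => eval s' e = 0 /\ exists m', I m' s').
  apply: wp_while => [|m s' [mn F iv] /=|]; last first.
  - by split; rewrite //= /upd eqxx ?addn0.
  - have v0 : var s' 0 = n.
      by rewrite F.1 //= !inE (eq_sym 0) (negbTE x0) mem_cat inE (eq_sym 0) (negbTE x0) orbF.
    rewrite v0 -mn addnK; case: m mn => // m mn _; exists m => //.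
    have vx : var (den c s') x = var s' x by rewrite (den_frame s' lf).1.
    rewrite vx addn1 /I (_ : var (set_var _ _ _) x = (var s' x).+1); last by rewrite /= /upd eqxx.
    split; first by rewrite -mn addSnnS.
      split=> [y|a].
        rewrite (_ : wvars _ = x :: (wvars c ++ [:: x])) // in_cons mem_cat !negb_or => /and3P[yx H1 H2].
        rewrite /= /upd (negbTE yx) (den_frame s' lf).1 // F.1 //=.
        by rewrite in_cons mem_cat !negb_or yx H1.
      rewrite (_ : warrs _ = warrs c ++ [::]) // => aH.
      by rewrite /= (den_frame s' lf).2 ?F.2 //; rewrite cats0 in aH.
    by apply: step => //; rewrite -mn addSn ltnS leq_addl.
  by rewrite /= lf.
have Ha : wp (Assign x (Const 0)) s 2 (eq (set_var s x 0)).
  exact: (wp_den (c := Assign x (Const 0))).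
have {}H := wp_seq Ha (fun s' Es => eq_ind _ (fun s' => wp _ s' _ _) H _ Es).
apply: wp_weaken H _ _ => [|s' [/= e0 [m [mn F iv]]]].
  rewrite /e /b /=; nia.
have v0 : var s' 0 = n.
  by rewrite F.1 //= !inE (eq_sym 0) (negbTE x0) mem_cat inE (eq_sym 0) (negbTE x0) orbF.
move: e0; rewrite v0 -mn addnK => m0; by rewrite m0 add0n.
Qed.

(** * Bounding the values computed by a linear-time run *)

(* [small e]: the value of [e] exceeds the largest cell of the state by at most
   [ecost e * n + econst e], where [n] is variable 0. *)
Fixpoint small e :=
  match e with
  | Add e1 (Const _) | Add e1 (Var 0) | Defs.Sub e1 _ => small e1
  | Add _ _ => false
  | _ => true
  end.

Fixpoint econst e :=
  match e with
  | Const k => k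
  | Var _ => 0
  | Get _ e1 => econst e1
  | Add e1 e2 | Defs.Sub e1 e2 => econst e1 + econst e2
  end.

Definition tame_expr K e := (ecost e <= K) && (econst e <= K).

Fixpoint tame K c :=
  match c with
  | Skip => true
  | Assign x e => [&& x != 0, small e & tame_expr K e]
  | Put _ i e => [&& tame_expr K i, small e & tame_expr K e]
  | Seq c1 c2 => tame K c1 && tame K c2
  | If e c1 c2 => [&& tame_expr K e, tame K c1 & tame K c2]
  | While e c => tame_expr K e && tame K c
  end.

Definition bounded M s := (forall x, var s x <= M) /\ (forall a i, arr s a i <= M).

Lemma small_le M s e : bounded M s -> small e -> eval s e <= M + ecost e * var s 0 + econst e.
Proof.
case=> bv ba; elim: e => [k _|x _|a e _ _|e1 IH1 e2 IH2|e1 IH1 e2 IH2 /IH1] /=.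
- exact: leq_addl.
- by have := bv x; lia.
- by have := ba a (eval s e); lia.
- by case: e2 {IH2} => //= [k|[|x]] // /IH1; lia.
- by nia.
Qed.

(** Intermediate values, unlike stored ones, may be sums of arbitrary cells and so may double at
    each operator; the cost of the expression bounds the number of doublings. *)
Lemma fits_le M s e : bounded M s -> forall W, 2 ^ ecost e * (M + econst e) <= W -> fits W s e.
Proof.
case=> bv ba.
suff H : forall e, fits (2 ^ ecost e * (M + econst e)) s e.
  by move=> W WW; apply: fits_mono WW (H e).
have ev e' W : fits W s e' -> eval s e' <= W by case: e' => [?|?|? ?|? ?|? ?] /= /andP[].
elim=> {e} [k|x|a e IH|e1 IH1 e2 IH2|e1 IH1 e2 IH2] /=; rewrite ?andbT expnS ?expn0.
- by lia.
- by have := bv x; lia.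
- have := ba a (eval s e); have : 0 < 2 ^ ecost e by rewrite expn_gt0.
  by move=> p b; apply/andP; split; [nia|apply: fits_mono IH; nia].
all: have p1 : 0 < 2 ^ ecost e1 by rewrite expn_gt0.
all: have p2 : 0 < 2 ^ ecost e2 by rewrite expn_gt0.
all: have v1 := ev _ _ IH1; have v2 := ev _ _ IH2; rewrite expnD.
all: set q1 := 2 ^ ecost e1 in p1 v1 IH1 *; set q2 := 2 ^ ecost e2 in p2 v2 IH2 *.
all: have h1 : q1 * (M + econst e1) <= q1 * q2 * (M + (econst e1 + econst e2)) by nia.
all: have h2 : q2 * (M + econst e2) <= q1 * q2 * (M + (econst e1 + econst e2)) by nia.
all: apply/and3P; split; [lia|apply: fits_mono IH1; lia|apply: fits_mono IH2; lia].
Qed.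

Lemma bounded_mono M M' s : M <= M' -> bounded M s -> bounded M' s.
Proof. by move=> MM [bv ba]; split=> *; apply: leq_trans MM. Qed.

Lemma bounded_var M s x v : bounded M s -> v <= M -> bounded M (set_var s x v).
Proof. by case=> bv ba vM; split=> // y; rewrite /= /upd; case: eqP. Qed.

Lemma bounded_arr M s a i v : bounded M s -> v <= M -> bounded M (set_arr s a i v).
Proof. by case=> bv ba vM; split=> // b j; rewrite /= /upd; case: eqP => // _; case: eqP. Qed.

(** Every unit of time raises the largest cell by at most [K * n.+1], and [2 ^ K] accounts for
    intermediate values. A tame program never assigns variable 0, so [n] stays the same
    throughout. *)
Lemma tame_exec K n W c s t s' : exec W c s t s' -> tame K c -> var s 0 = n ->
  forall M, bounded M s -> forall W', 2 ^ K * (M + t * (K * n.+1) + K) <= W' ->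
  [/\ exec W' c s t s', bounded (M + t * (K * n.+1)) s' & var s' 0 = n].
Proof.
have fit M s0 e W' t0 : bounded M s0 -> tame_expr K e ->
    2 ^ K * (M + t0 * (K * n.+1) + K) <= W' -> fits W' s0 e.
  move=> b /andP[h1 h2] h3; apply: (fits_le b); apply: leq_trans h3.
  apply: leq_mul; first by rewrite leq_exp2l.
  by lia.
have grow M s0 e : bounded M s0 -> var s0 0 = n -> small e -> tame_expr K e ->
    eval s0 e <= M + K * n.+1.
  move=> b v0 sm /andP[h1 h2]; apply: leq_trans (small_le b sm) _; rewrite v0; nia.
elim=> {c s t s'} /=.
- by move=> s _ v0 M b W' _; split=> //; [constructor|apply: bounded_mono b; lia].
- move=> s x e _ /and3P[x0 sm te] v0 M b W' HW.
  split; first by constructor; apply: fit HW.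
    apply: bounded_var; first by apply: bounded_mono b; lia.
    by apply: leq_trans (grow _ _ _ b v0 sm te) _; nia.
  by rewrite /= /upd eq_sym (negbTE x0).
- move=> s a i e _ _ /and3P[ti sm te] v0 M b W' HW.
  split=> //; first by constructor; apply: fit HW.
  apply: bounded_arr; first by apply: bounded_mono b; lia.
  by apply: leq_trans (grow _ _ _ b v0 sm te) _; nia.
- move=> s1 s2 s3 c1 c2 t1 t2 _ IH1 _ IH2 /andP[m1 m2] v0 M b W' HW.
  have [|E1 b1 v1] := IH1 m1 v0 M b W'; first by apply: leq_trans HW; nia.
  have [|E2 b2 v2] := IH2 m2 v1 _ b1 W'; first by apply: leq_trans HW; nia.
  by split=> //; [apply: ExecSeq E1 E2|apply: bounded_mono b2; nia].
- move=> s s' e c1 c2 t _ e0 _ IH /and3P[te m1 m2] v0 M b W' HW.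
  have [|E b1 v1] := IH m1 v0 M b W'; first by apply: leq_trans HW; nia.
  by split=> //; [apply: ExecIfT => //; apply: fit HW|apply: bounded_mono b1; nia].
- move=> s s' e c1 c2 t _ e0 _ IH /and3P[te m1 m2] v0 M b W' HW.
  have [|E b1 v1] := IH m2 v0 M b W'; first by apply: leq_trans HW; nia.
  by split=> //; [apply: ExecIfF => //; apply: fit HW|apply: bounded_mono b1; nia].
- move=> s1 s2 s3 e c t1 t2 _ e0 _ IH1 _ IH2 /[dup] /andP[te m1] m2 v0 M b W' HW.
  have [|E1 b1 v1] := IH1 m1 v0 M b W'; first by apply: leq_trans HW; nia.
  have [|E2 b2 v2] := IH2 m2 v1 _ b1 W'; first by apply: leq_trans HW; nia.
  by split=> //; [apply: ExecWhileT E1 E2 => //; apply: fit HW|apply: bounded_mono b2; nia].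
- move=> s e c _ e0 /andP[te _] v0 M b W' HW.
  by split=> //; [apply: ExecWhileF => //; apply: fit HW|apply: bounded_mono b; lia].
Qed.

Fixpoint tame_const c :=
  match c with
  | Skip => 0
  | Assign x e => ecost e + econst e
  | Put _ i e => ecost i + econst i + (ecost e + econst e)
  | Seq c1 c2 => tame_const c1 + tame_const c2
  | If e c1 c2 => ecost e + econst e + (tame_const c1 + tame_const c2)
  | While e c => ecost e + econst e + tame_const c
  end.

Fixpoint tame0 c :=
  match c with
  | Skip => true
  | Assign x e => (x != 0) && small e
  | Put _ i e => small e
  | Seq c1 c2 | If _ c1 c2 => tame0 c1 && tame0 c2
  | While e c => tame0 c
  end.

Lemma tame0P c K : tame0 c -> tame_const c <= K -> tame K c.
Proof.
rewrite /tame_expr; elim: c => //=.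
- by move=> x e /andP[-> ->] /=; rewrite /tame_expr; lia.
- by move=> a i e ->; rewrite /tame_expr; lia.
- by move=> c1 IH1 c2 IH2 /andP[m1 m2] le; rewrite IH1 ?IH2 //; lia.
- by move=> e c1 IH1 c2 IH2 /andP[m1 m2] le; rewrite /tame_expr IH1 ?IH2 //; lia.
by move=> e c IH m le; rewrite /tame_expr IH //; lia.
Qed.

(** The exponent has three sources: [2 ^ K] is at most [n.+2 ^ K]; the cells stay below a constant
    times [n.+2 ^ 2], as at most [T * n.+1] units add [K * n.+1] each; and a constant [b] is at most
    [2 ^ b], hence at most [n.+2 ^ b]. *)
Lemma run_exec c s t s' n M0 T : run c s t s' -> tame0 c -> var s 0 = n ->
  bounded (M0 * n.+1) s -> t <= T * n.+1 ->
  exec (n.+2 ^ (tame_const c + (M0 + T * tame_const c + tame_const c) + 2)) c s t s'.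
Proof.
case=> W E tm v0 b tT; pose K := tame_const c.
have [|//] := tame_exec E (tame0P tm (leqnn _)) v0 b (W' := n.+2 ^ (K + (M0 + T * K + K) + 2)).
have ex e : 2 ^ e <= n.+2 ^ e by case: e => // e; rewrite leq_exp2r.
rewrite -/K expnD expnD -mulnA; apply: leq_mul; first exact: ex.
apply: (@leq_trans ((M0 + T * K + K) * (n.+2 ^ 2))).
  rewrite expnS expn1; nia.
rewrite leq_mul2r; apply/orP; right; apply: ltnW.
exact: leq_trans (ltn_expl _ (leqnn 2)) (ex _).
Qed.

(** * Building the arcs *)

Definition neq x y := Add (Defs.Sub (Var x) (Var y)) (Defs.Sub (Var y) (Var x)).
Definition incr x := Assign x (Add (Var x) (Const 1)).
Definition incr_at a e := Put a e (Add (Get a e) (Const 1)).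
Definition decr_at a e := Put a e (Defs.Sub (Get a e) (Const 1)).
Definition seqs := foldr Seq Skip.

(* Memory layout.  Array 4 holds the arcs: letter [l] of vertex [v] is at [l * n + v];
   array 5 holds the multiples of [n]; array 6 is the [n] by [n] table of the pairs
   enqueued so far; the queue of pairs is in arrays 7 and 8, between the variables 4
   and 3; array 9 holds the degrees in the queue; array 10, the next free letter. *)
Definition letter_at l e := Add (Get 5 l) e.

Definition enqueue :=
  Seq (Put 7 (Var 3) (Var 1)) (Seq (Put 8 (Var 3) (Var 2)) (incr 3)).

(** The table records ordered pairs and is kept across levels, so a pair enqueued at an earlier
    level is never enqueued again. *)
Definition add_pair :=
  If (neq 1 2)
    (If (Get 6 (Add (Get 5 (Var 1)) (Var 2))) Skip
      (Seq (Put 6 (Add (Get 5 (Var 1)) (Var 2)) (Const 1))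
      (Seq (incr_at 9 (Var 1)) (Seq (incr_at 9 (Var 2)) enqueue))))
    Skip.

(** Two nested loops are merged into one with a loop-free body: each pass either consumes an entry
    of the neighbor lists or moves on to the next vertex, so the passes number the vertices plus the
    entries. *)
Definition edge_scan :=
  Seq (Assign 5 (Const 0)) (Seq (Assign 6 (Const 0))
    (While (Defs.Sub (Var 0) (Var 5))
      (If (Defs.Sub (Get 0 (Add (Var 5) (Const 1))) (Var 6))
        (Seq (Assign 1 (Var 5)) (Seq (Assign 2 (Get 1 (Var 6))) (Seq add_pair (incr 6))))
        (incr 5)))).

Definition fork_cmd l l' :=
  Seq (Assign 1 (Get 4 (letter_at (Const l) (Var 5))))
  (Seq (Assign 2 (Get 4 (letter_at (Const l') (Var 5))))
  (If (neq 1 5) (If (neq 2 5) add_pair Skip) Skip)).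

Definition fork_pairs wts d :=
  [seq p <- [seq (l, l') | l <- iota 0 (size wts), l' <- iota 0 (size wts)]
    | nth 0 wts p.1 + nth 0 wts p.2 == d].

Definition fork_scan wts d := For 5 (seqs [seq fork_cmd p.1 p.2 | p <- fork_pairs wts d]).

Definition give x y :=
  Seq (Put 4 (letter_at (Get 10 (Var x)) (Var x)) (Var y))
  (Seq (incr_at 10 (Var x)) (Seq (decr_at 9 (Var x)) (decr_at 9 (Var y)))).

Definition orient_step Dl :=
  Seq (Assign 1 (Get 7 (Var 4))) (Seq (Assign 2 (Get 8 (Var 4))) (Seq (incr 4)
    (If (Defs.Sub (Const Dl.+1) (Get 9 (Var 1))) (give 1 2)
      (If (Defs.Sub (Const Dl.+1) (Get 9 (Var 2))) (give 2 1) enqueue)))).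

Definition orient Dl := While (Defs.Sub (Var 3) (Var 4)) (orient_step Dl).

Lemma neqE x y s : (eval s (neq x y) != 0) = (var s x != var s y).
Proof. by rewrite /=; case: eqP; lia. Qed.

Lemma loop_free_seqs (cs : seq cmd) : loop_free (seqs cs) = all loop_free cs.
Proof. by elim: cs => //= c cs ->. Qed.

Definition writes_in (vs als : seq nat) c :=
  {subset wvars c <= vs} /\ {subset warrs c <= als}.

Lemma writes_in_seqs (T : eqType) (F : T -> cmd) (ps : seq T) vs als :
  (forall p, p \in ps -> writes_in vs als (F p)) -> writes_in vs als (seqs [seq F p | p <- ps]).
Proof.
elim: ps => [|p ps IH] H; first by split.
have [v1 a1] := H p (mem_head _ _).
have [|v2 a2] := IH; first by move=> r rr; apply: H; rewrite inE rr orbT.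
by split=> x /=; rewrite mem_cat => /orP[]; [apply: v1|apply: v2|apply: a1|apply: a2].
Qed.

Lemma frame_for vs als x c s s' : writes_in vs als c -> frame (For x c) s s' ->
  (forall y, y \notin x :: vs -> var s' y = var s y) /\
  (forall a, a \notin als -> arr s' a = arr s a).
Proof.
case=> Wv Wa [Fv Fa]; split=> y yn; [apply: Fv|apply: Fa]; apply: contra yn.
  rewrite [wvars _]/= !in_cons mem_cat => /or3P[->//|/Wv ->|]; first by rewrite orbT.
  by rewrite inE => ->.
by rewrite [warrs _]/= cats0; apply: Wa.
Qed.

Section Programs.
Variables (G : sgraph) (I : adjlists G).
Notation nm := (num I).
Notation n := (#|{: G}|).

Lemma size_verts : size (verts I) = n.
Proof. by rewrite (perm_size (vertsP I)) -cardE. Qed.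

Lemma mem_verts v : v \in verts I.
Proof. by rewrite (perm_mem (vertsP I)) mem_enum. Qed.

Lemma num_lt v : nm v < n.
Proof. by rewrite -size_verts index_mem mem_verts. Qed.

Lemma num_eq u v : (nm u == nm v) = (u == v).
Proof.
apply/eqP/eqP => [E|->//]; rewrite -(nth_index u (mem_verts u)) -[RHS](nth_index u (mem_verts v)).
by rewrite [index u _]E.
Qed.

Lemma num_surj i : i < n -> exists v, nm v = i.
Proof.
rewrite -size_verts => ii.
have [v0 _] : exists v0 : G, true by case: (verts I) ii => // v0; exists v0.
exists (nth v0 (verts I) i); rewrite /num index_uniq //.
by rewrite (perm_uniq (vertsP I)) enum_uniq.
Qed.

Lemma cell_eq a a' b b' : (a * n + nm b == a' * n + nm b') = (a == a') && (b == b').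
Proof.
have h := num_lt b; have h' := num_lt b'.
apply/eqP/andP => [E|[/eqP -> /eqP -> //]].
have Ea : a = a'.
  have := congr1 (divn^~ n) E.
  by rewrite !divnMDl ?divn_small ?addn0 //; lia.
by rewrite -num_eq Ea eqxx; move: E; rewrite Ea => /addnI ->.
Qed.

(** Expressions have no multiplication, so row offsets are tabulated: [j < n] for the rows of the
    pair table, [j < L] for the letters, whose number may exceed [n]. *)
Definition multiples L s := forall j, (j < n) || (j < L) -> arr s 5 j = j * n.
Definition arcs_at L s (g : nat -> G -> G) :=
  forall l v, l < L -> arr s 4 (l * n + nm v) = nm (g l v).

Definition queue s (q : seq (G * G)) :=
  [/\ var s 3 = var s 4 + size q,
   forall i, i < size q -> arr s 7 (var s 4 + i) = nth 0 [seq nm p.1 | p <- q] i &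
   forall i, i < size q -> arr s 8 (var s 4 + i) = nth 0 [seq nm p.2 | p <- q] i].

Definition degree (q : seq (G * G)) v := count (fun p => p.1 == v) q + count (fun p => p.2 == v) q.
Definition degrees s q := forall v, arr s 9 (nm v) = degree q v.

Definition marks s (mk : pred (G * G)) := forall a b, (arr s 6 (nm a * n + nm b) != 0) = mk (a, b).

(** * Collecting the pairs of a level *)

Section Collect.
Variables (L : nat) (mk : pred (G * G)) (R : G -> G -> Prop).

(** [mk] is the table as it stood before the level, and [R] is the reason that admits a pair: being
    an edge or the ends of a fork. *)
Record collected s q : Prop := Collected {
  coll_mult : multiples L s;
  coll_queue : queue s q;
  coll_deg : degrees s q;
  coll_marks : marks s (fun p => mk p || (p \in q));
  coll_uniq : uniq q;
  coll_R : forall a b, (a, b) \in q -> a != b /\ R a b }.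

Lemma add_pair_collected s q a b :
  collected s q -> var s 1 = nm a -> var s 2 = nm b -> R a b ->
  exists q', [/\ collected (den add_pair s) q', {subset q <= q'} &
    a != b -> mk (a, b) || ((a, b) \in q')].
Proof.
move=> C va vb Rab; have [Cm [Cq1 Cq2 Cq3] Cd Ck Cu CR] := C.
have ma : arr s 5 (nm a) = nm a * n by apply: Cm; rewrite num_lt.
have E6 : eval s (Get 6 (Add (Get 5 (Var 1)) (Var 2))) = arr s 6 (nm a * n + nm b).
  by rewrite /= va vb ma.
rewrite /add_pair; cbn [den]; rewrite neqE va vb num_eq.
case: eqP => [ab|/eqP ab] /=; first by exists q; split=> //; rewrite ab eqxx.
have /= -> := E6; rewrite Ck; case: ifP => [Hk|/negbT].
  by exists q; split=> // _.
rewrite negb_or => /andP[nk nq]; exists (rcons q (a, b)); split; last 2 first.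
- by move=> p pq; rewrite mem_rcons inE pq orbT.
- by rewrite mem_rcons mem_head orbT.
rewrite va vb ma; split.
- by move=> j jn; rewrite /= /upd /= Cm.
- split; rewrite /= /upd /= ?va ?vb Cq1 ?size_rcons ?addn1 ?addnS // map_rcons => i.
  + rewrite ltnS leq_eqVlt nth_rcons size_map => /orP[/eqP ->|ii]; first by rewrite ltnn !eqxx.
    by rewrite eqn_add2l (ltn_eqF ii) ii Cq2.
  rewrite ltnS leq_eqVlt nth_rcons size_map => /orP[/eqP ->|ii]; first by rewrite ltnn !eqxx.
  by rewrite eqn_add2l (ltn_eqF ii) ii Cq3.
- move=> v; rewrite /= /upd /= ?va ?vb /degree -!cats1 !count_cat /= !num_eq !addn0.
  rewrite (eq_sym a v) (eq_sym b v) !Cd /degree.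
  by case: (eqVneq v b) (eqVneq v a) ab => [->|nb] [->|na]; rewrite ?eqxx //= ?(eq_sym b) ?(negbTE nb) ?(negbTE na) //; lia.
- move=> x y; rewrite /= /upd /= cell_eq num_eq mem_rcons inE xpair_eqE.
  by case: ((x == a) && (y == b)); rewrite ?orbT //= Ck.
- by rewrite rcons_uniq nq.
move=> x y; rewrite mem_rcons inE => /orP[/eqP[-> ->]|]; [by []|exact: CR].
Qed.
Lemma offset_step x : nm x < n ->
  arr (input I) 0 (nm x).+1 = arr (input I) 0 (nm x) + size (nbrs I x).
Proof.
move=> xn; rewrite /= xn (ltnW xn).
rewrite (take_nth 0) ?size_map ?size_verts // sumn_rcons.
by rewrite (nth_map x) ?size_verts // nth_index ?mem_verts.
Qed.

Lemma nth_flatten_take (ss : seq (seq nat)) i j : i < size ss -> j < size (nth [::] ss i) ->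
  nth 0 (flatten ss) (sumn (take i [seq size r | r <- ss]) + j) = nth 0 (nth [::] ss i) j.
Proof.
elim: ss i => // r ss IH [|i] /= ii jj; first by rewrite nth_cat jj.
by rewrite nth_cat -addnA ltnNge leq_addr /= addKn IH.
Qed.

Lemma nbr_entry x j : j < size (nbrs I x) ->
  arr (input I) 1 (arr (input I) 0 (nm x) + j) = nm (nth x (nbrs I x) j).
Proof.
move=> jx; have xn := num_lt x; rewrite /= (ltnW xn).
set ss := [seq _ | v <- _].
have -> : [seq size (nbrs I v) | v <- verts I] = [seq size r | r <- ss].
  by rewrite -map_comp; apply: eq_map => v; rewrite /= size_map.
have Es : nth [::] ss (nm x) = [seq nm w | w <- nbrs I x].
  by rewrite (nth_map x) ?size_verts // nth_index ?mem_verts.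
rewrite nth_flatten_take ?Es ?size_map ?size_verts // (nth_map x) //.
Qed.

Definition inputs s := [/\ var s 0 = n, arr s 0 = arr (input I) 0 & arr s 1 = arr (input I) 1].
Definition degree_sum := arr (input I) 0 n.

Lemma add_pair_frame s : frame add_pair s (den add_pair s).
Proof. exact: den_frame. Qed.

Lemma collected_frame s s' q : collected s q ->
  (forall a, a \in [:: 5; 6; 7; 8; 9] -> arr s' a = arr s a) ->
  var s' 3 = var s 3 -> var s' 4 = var s 4 -> collected s' q.
Proof.
move=> [Cm [Cq1 Cq2 Cq3] Cd Ck Cu CR] Ha v3 v4; split=> //.
- by move=> j; rewrite Ha //; apply: Cm.
- by split=> [|i|i]; rewrite ?v3 ?v4 // Ha //; [apply: Cq2|apply: Cq3].
- by move=> v; rewrite Ha //; apply: Cd.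
by move=> a b; rewrite Ha //; apply: Ck.
Qed.

Lemma offset_mono i j : i <= j -> j <= n -> arr (input I) 0 i <= arr (input I) 0 j.
Proof.
move=> ij jn; rewrite /= jn (leq_trans ij jn).
rewrite -[in X in _ <= X](cat_take_drop i (take j _)) sumn_cat take_takel //.
exact: leq_addr.
Qed.

Lemma edge_scan_spec s q0 : collected s q0 -> inputs s -> (forall a b, edge a b -> R a b) ->
  wp edge_scan s (100 * (n + degree_sum).+1) (fun s' => exists q, [/\ collected s' q,
    {subset q0 <= q} & forall a b, edge a b -> mk (a, b) || ((a, b) \in q)]).
Proof.
move=> C0 I0 ER.
pose scanned v j (a b : G) := edge a b /\
  (nm a < v \/ nm a = v /\ arr (input I) 0 v + index b (nbrs I a) < j).
pose Inv m s' := exists q, [/\ collected s' q, inputs s', {subset q0 <= q},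
  forall a b, scanned (var s' 5) (var s' 6) a b -> mk (a, b) || ((a, b) \in q) &
  [/\ m + var s' 5 + var s' 6 = n + degree_sum, var s' 5 <= n,
      arr (input I) 0 (var s' 5) <= var s' 6 &
      var s' 5 < n -> var s' 6 <= arr (input I) 0 (var s' 5).+1]].
apply: (wp_weaken (T := (1 + (1 + (n + degree_sum).+1 * 90).+2).+2)); last 2 first.
- by lia.
- exact: (fun s' H => H).
apply: wp_assign_seq; apply: wp_assign_seq.
set s1 := set_var _ _ _.
have I1 : Inv (n + degree_sum) s1.
  exists q0; split=> //; first by apply: collected_frame C0 _ _ _.
  - by move=> a b [_ [//|[_]]]; rewrite /= ltn0.
  - by rewrite /s1 /= !addn0 take0; split.
have step m s' : Inv m s' -> eval s' (Defs.Sub (Var 0) (Var 5)) != 0 ->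
    exists2 m', m = m'.+1 & Inv m' (den (If (Defs.Sub (Get 0 (Add (Var 5) (Const 1))) (Var 6))
        (Seq (Assign 1 (Var 5)) (Seq (Assign 2 (Get 1 (Var 6))) (Seq add_pair (incr 6))))
        (incr 5)) s').
  case=> q [C [i0 i1 i2] qq Hs [mE v5 o1 o2]] /=; rewrite i0 => v5n.
  have {}v5n : var s' 5 < n by lia.
  have [x xv] := num_surj v5n.
  have oS := offset_step (num_lt x); rewrite xv in oS.
  rewrite i1 addn1; set o := arr (input I) 0 in oS o1 o2 *.
  have [lt|ge] := boolP (o (var s' 5).+1 - var s' 6 != 0); last first.
    have E6 : var s' 6 = o (var s' 5).+1 by have := o2 v5n; lia.
    have : var s' 6 <= degree_sum by rewrite E6; apply: offset_mono.
    case: m mE => [|m] mE dd; first by lia.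
    exists m => //; exists q; split=> //; first by apply: collected_frame C _ _ _.
      move=> a b; rewrite /= /upd /= => -[ab []]; last first.
        by case=> _; rewrite -/o E6 ltnNge leq_addr.
      rewrite ltnS leq_eqVlt => /orP[/eqP av|av]; apply: Hs; split=> //; last by left.
      right; split=> //; rewrite -/o E6 oS.
      have ax : a = x by apply/eqP; rewrite -num_eq av xv.
      by rewrite ax ltn_add2l index_mem (perm_mem (nbrsP I x)) mem_enum inE -ax.
    rewrite /= /upd /=; split; rewrite -?/o.
    - by rewrite -mE addSn addnS.
    - by [].
    - by rewrite E6.
    by move=> lt; rewrite E6; apply: offset_mono.
  set j := var s' 6 - o (var s' 5).
  have jx : j < size (nbrs I x) by rewrite /j; lia.
  have E6 : var s' 6 = o (var s' 5) + j by rewrite /j; lia.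
  have le : var s' 6 < degree_sum.
    by apply: (@leq_trans (o (var s' 5).+1)); [lia|apply: offset_mono].
  case: m mE => [|m] mE; first by lia.
  exists m => //.
  pose y := nth x (nbrs I x) j.
  have xy : edge x y.
    have : y \in nbrs I x by apply: mem_nth.
    by rewrite (perm_mem (nbrsP I x)) mem_enum inE.
  set s2 := set_var (set_var s' 1 (var s' 5)) 2 (arr s' 1 (var s' 6)).
  have C2 : collected s2 q by apply: collected_frame C _ _ _.
  have [||q' [C' qq' Hq']] := add_pair_collected C2 (a := x) (b := y) _ _ (ER _ _ xy).
  - by rewrite /= /upd /= -xv.
  - by rewrite /= /upd /= i2 E6 -xv nbr_entry.
  have [fv fa] := add_pair_frame s2.
  exists q'; split.
  - by apply: collected_frame C' _ _ _.
  - by split; rewrite ?(fa 0) ?(fa 1) //= /upd /= fv.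
  - by move=> p /qq /qq'.
  - move=> a b; rewrite -/(add_pair).
    have -> : var (den (incr 6) (den add_pair s2)) 6 = (var s' 6).+1.
      by rewrite /= /upd /= fv //= addn1.
    have -> : var (den (incr 6) (den add_pair s2)) 5 = var s' 5.
      by rewrite /= /upd /= fv.
    case=> ab H.
    have [xyab|nxy] := eqVneq (a, b) (x, y).
      rewrite xyab; apply: Hq'.
      by apply/eqP => exy; rewrite exy edge_irrefl in xy.
    have : mk (a, b) || ((a, b) \in q).
      apply: Hs; split=> //; case: H => [|[av]]; first by left.
      rewrite -/o E6 ltnS leq_eqVlt => /orP[|lt']; last by right.
      rewrite eqn_add2l => /eqP jE.
      have ax : a = x by apply/eqP; rewrite -num_eq av xv.
      case/eqP: nxy; rewrite /y -jE ax nth_index // (perm_mem (nbrsP I x)) mem_enum inE -ax //.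
    by case/orP=> [->//|/qq' ->]; rewrite orbT.
  have -> : var (den (incr 6) (den add_pair s2)) 6 = (var s' 6).+1.
    by rewrite /= /upd /= fv //= addn1.
  have -> : var (den (incr 6) (den add_pair s2)) 5 = var s' 5.
    by rewrite /= /upd /= fv.
  by split; rewrite -?/o; lia.
have H := wp_while (e := Defs.Sub (Var 0) (Var 5)) _ step I1.
apply: wp_weaken (H _) _ _ => //= [|s' [e0 [m [q [C [i0 _ _] qq Hs [mE v5 o1 o2]]]]]].
  by lia.
exists q; split=> // a b ab; apply: Hs; split=> //; left.
by have := num_lt a; rewrite i0 in e0; lia.
Qed.
Lemma fork_cmd_collected g s q l l' v : collected s q -> arcs_at L s g -> l < L -> l' < L ->
  var s 5 = nm v ->
  (g l v != v -> g l' v != v -> g l v != g l' v -> R (g l v) (g l' v)) ->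
  exists q', [/\ collected (den (fork_cmd l l') s) q', {subset q <= q'} &
    g l v != v -> g l' v != v -> g l v != g l' v ->
    mk (g l v, g l' v) || ((g l v, g l' v) \in q')].
Proof.
move=> C A ll ll' v5 HR.
pose s2 := set_var (set_var s 1 (nm (g l v))) 2 (nm (g l' v)).
have C2 : collected s2 q by apply: collected_frame C _ _ _.
have -> : den (fork_cmd l l') s = den (If (neq 1 5) (If (neq 2 5) add_pair Skip) Skip) s2.
  have m1 : arr s 5 l = l * n by apply: (coll_mult C); rewrite ll orbT.
  have m2 : arr s 5 l' = l' * n by apply: (coll_mult C); rewrite ll' orbT.
  by rewrite /fork_cmd /s2; cbn [den letter_at eval]; rewrite /set_var /= /upd /= m1 m2 v5 !A.
cbn [den]; rewrite !neqE (_ : var s2 1 = nm (g l v)) // (_ : var s2 2 = nm (g l' v)) //.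
rewrite (_ : var s2 5 = nm v) // !num_eq.
case: eqP => [e1|/eqP n1] /=; first by exists q; split=> //; rewrite e1 eqxx.
case: eqP => [e2|/eqP n2] /=; first by exists q; split=> //; rewrite e2 eqxx.
have [e3|n3] := eqVneq (g l v) (g l' v).
  by exists q; split=> //; rewrite ?e3 ?eqxx // /= /upd /= subnn.
have [q' [C' qq' H]] := add_pair_collected C2 (erefl _) (erefl _) (HR n1 n2 n3).
by exists q'; split=> // _ _ _; apply: H.
Qed.

Lemma fork_cmd_writes l l' : writes_in [:: 1; 2; 3] [:: 6; 7; 8; 9] (fork_cmd l l').
Proof. by split=> x; rewrite !inE => H; move: H; do ![case: eqP => //= _]. Qed.

Lemma fork_scan_spec g wts d s q0 : collected s q0 -> arcs_at L s g -> size wts <= L -> var s 0 = n ->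
  (forall a b, fork wts g d a b -> R a b) ->
  wp (fork_scan wts d) s (n.+1 * (bcost (seqs [seq fork_cmd p.1 p.2 | p <- fork_pairs wts d]) + 10)).*2
    (fun s' => exists q, [/\ collected s' q, {subset q0 <= q} &
      forall a b, fork wts g d a b -> mk (a, b) || ((a, b) \in q)]).
Proof.
move=> C0 A0 wL v0 HR; pose ps := fork_pairs wts d.
have [Wv Wa] : writes_in [:: 1; 2; 3] [:: 6; 7; 8; 9] (seqs [seq fork_cmd p.1 p.2 | p <- ps]).
  by apply: writes_in_seqs => p _; apply: fork_cmd_writes.
have lf : loop_free (seqs [seq fork_cmd p.1 p.2 | p <- ps]).
  by rewrite loop_free_seqs all_map; apply/allP.
pose done (q : seq (G * G)) v (p : nat * nat) := g p.1 v != v -> g p.2 v != v -> g p.1 v != g p.2 v ->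
    mk (g p.1 v, g p.2 v) || ((g p.1 v, g p.2 v) \in q).
pose Inv i s' := exists q, [/\ collected s' q, {subset q0 <= q} &
  forall v p, p \in ps -> nm v < i -> done q v p].
have psP p : p \in ps -> [/\ p.1 < size wts, p.2 < size wts & nth 0 wts p.1 + nth 0 wts p.2 = d].
  rewrite mem_filter => /andP[/eqP pd /allpairsP[[l l'] /= []]].
  by rewrite !mem_iota /= !add0n => pl pl' ep; rewrite ep in pd *.
apply: wp_weaken (wp_for (n := n) (Inv := Inv) lf _ _ v0 _ _) (leqnn _) _.
- by apply/negP; rewrite inE /= => /Wv.
- by apply/negP => /Wv.
- by exists q0; split=> //; apply: collected_frame C0 _ _ _.
- move=> i s1 iN [Fv Fa] v5 [q1 [C1 qq1 Hd]].
  have [v vi] := num_surj iN.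
  have A1 : arcs_at L s1 g by move=> l w lL; rewrite Fa ?A0 //=; apply/negP; rewrite cats0 => /Wa.
  suff {Wv Wa lf Inv Fv Fa} H : forall rs s2 q2, {subset rs <= ps} -> collected s2 q2 -> arcs_at L s2 g -> var s2 5 = nm v ->
      exists q', [/\ collected (den (seqs [seq fork_cmd p.1 p.2 | p <- rs]) s2) q', {subset q2 <= q'} &
        forall p, p \in rs -> done q' v p].
    have [|q' [C' qq' H']] := H ps s1 q1 (fun p H => H) C1 A1; first by rewrite v5.
    exists q'; split; [by apply: collected_frame C' _ _ _|by move=> p /qq1/qq'|].
    move=> u p pps; rewrite ltnS leq_eqVlt -vi num_eq => /orP[/eqP ->|ui]; first exact: H'.
    by rewrite vi in ui; move=> h1 h2 h3; case/orP: (Hd _ _ pps ui h1 h2 h3) => [->//|/qq' ->]; rewrite orbT.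
  elim=> [|p rs IH] s2 q2 sub C2 A2 v2; first by exists q2; split.
  have [l1 l2 pd] := psP p (sub _ (mem_head _ _)).
  have [q3 [C3 qq3 H3]] : exists q', [/\ collected (den (fork_cmd p.1 p.2) s2) q',
      {subset q2 <= q'} & done q' v p].
    apply: (@fork_cmd_collected g s2 q2 p.1 p.2 v C2 A2 _ _ v2) => [||h1 h2 h3]; first exact: leq_trans wL; first exact: leq_trans wL.
    by apply: HR; exists p.1, p.2, v.
  have [fv fa] : frame (fork_cmd p.1 p.2) s2 (den (fork_cmd p.1 p.2) s2) by apply: den_frame.
  have [|||q4 [C4 qq4 H4]] := IH _ q3 _ C3.
  - by move=> r rr; apply: sub; rewrite inE rr orbT.
  - by move=> l w lL; rewrite fa // A2.
  - by rewrite fv.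
  exists q4; split=> //; first by move=> r /qq3/qq4.
  move=> r; rewrite inE => /orP[/eqP ->|/H4 //] h1 h2 h3.
  by case/orP: (H3 h1 h2 h3) => [->//|/qq4 ->]; rewrite orbT.
move=> s' [q [C qq H]]; exists q; split=> // a b [l [l' [v [l1 l2 ld [-> -> h1 h2 h3]]]]].
apply: (H v (l, l')) => //; last exact: num_lt.
by rewrite mem_filter /= ld eqxx /=; apply/allpairsP; exists (l, l'); rewrite !mem_iota.
Qed.
End Collect.

(** * Orienting the pairs by passes that halve the queue *)

Section Orient.
Variables (L off Dl K : nat) (E : {set G * G}) (g : nat -> G -> G).
Hypothesis offL : off + Dl <= L.
Hypothesis DlK : Dl.+1 = 4 * K.
Hypothesis E_irr : forall a b, (a, b) \in E -> a != b.
Hypothesis dense : forall U : {set G}, #|[set e in E | (e.1 \in U) && (e.2 \in U)]| <= K * #|U|.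

(* [dq] lists the pairs not yet turned into an arc: the queue itself, except
   between the removal of its head and the processing of this pair. *)
Record oriented s (q dq : seq (G * G)) (g' : nat -> G -> G) (cn : G -> nat) : Prop := Oriented {
  or_mult : multiples L s;
  or_arcs : arcs_at L s g';
  or_queue : queue s q;
  or_deg : degrees s dq;
  or_cnt : forall v, arr s 10 (nm v) = cn v;
  or_off : forall v, off <= cn v;
  or_room : forall v, cn v = off \/ cn v + degree dq v <= off + Dl;
  or_old : forall l v, l < off -> g' l v = g l v;
  or_free : forall l v, cn v <= l -> l < L -> g' l v = v;
  or_E : forall l v, off <= l < cn v -> (v, g' l v) \in E \/ (g' l v, v) \in E;
  or_cover : forall a b, (a, b) \in E -> (a, b) \in dq \/
    exists l, (off <= l < cn a) && (g' l a == b) || (off <= l < cn b) && (g' l b == a);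
  or_uniq : uniq dq;
  or_sub : {subset dq <= E} }.

Lemma degree_perm q q' v : perm_eq q q' -> degree q v = degree q' v.
Proof. by move=> /permP H; rewrite /degree !H. Qed.

Lemma oriented_perm s q dq dq' g' cn : perm_eq dq dq' ->
  oriented s q dq g' cn -> oriented s q dq' g' cn.
Proof.
move=> pq [] *; split=> //.
- by move=> v; rewrite -(degree_perm _ pq).
- by move=> v; rewrite -(degree_perm _ pq).
- by move=> a b; rewrite -(perm_mem pq); auto.
- by rewrite -(perm_uniq pq).
by move=> p; rewrite -(perm_mem pq); auto.
Qed.

(** No vertex runs out of letters. At its first gift [x] has at most [Dl] pending pairs; from then
    on each gift to [x] uses one letter and removes one of its pairs, so the used letters plus the
    pending pairs never exceed [Dl]. This is what [or_room] records. *)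
Lemma give_oriented i j s x y p q g' cn : oriented s q (p :: q) g' cn ->
  var s i = nm x -> var s j = nm y -> p = (x, y) \/ p = (y, x) -> degree (p :: q) x <= Dl ->
  exists g'' cn', oriented (den (give i j) s) q q g'' cn'.
Proof.
move=> O vi vj pxy dx; case: (O) => Om Oa Oq Od Oc Oo Or Ool Of OE Ov Ou0 Os.
have [pq Ou] : p \notin q /\ uniq q by apply/andP.
have pE : p \in E by apply: Os; rewrite mem_head.
have xy : x != y by case: pxy pE => -> /E_irr //; rewrite eq_sym.
have Dp v : degree (p :: q) v = (v == x) + (v == y) + degree q v.
  by rewrite /degree /=; case: pxy => ->; rewrite /= (eq_sym x) (eq_sym y); lia.
have cx : cn x + degree (p :: q) x <= off + Dl by case: (Or x) => [->|//]; rewrite leq_add2l.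
have cL : cn x < L by apply: leq_trans offL; move: cx; rewrite Dp eqxx; lia.
have mx : arr s 5 (cn x) = cn x * n by apply: Om; rewrite cL orbT.
exists (fun l v => if (l == cn x) && (v == x) then y else g' l v),
  (fun v => if v == x then (cn x).+1 else cn v).
have E4 : arr (den (give i j) s) 4 = upd (arr s 4) (cn x * n + nm x) (nm y).
  by rewrite /= /upd /= vi vj Oc mx.
have E5 : arr (den (give i j) s) 5 = arr s 5 by [].
have E10 : arr (den (give i j) s) 10 = upd (arr s 10) (nm x) (cn x).+1.
  by rewrite /= /upd /= vi Oc addn1.
have E9 v : arr (den (give i j) s) 9 (nm v) = degree q v.
  rewrite /= /upd /= vi vj !num_eq !Od !Dp (negbTE xy) (eq_sym y x) (negbTE xy) eqxx.
  case: (eqVneq v x) => [->|vx]; first by rewrite eqxx (negbTE xy); lia.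
  by have [<-|_] := eqVneq v y; lia.
have E7 : queue (den (give i j) s) q by case: Oq.
move: (den _ s) E4 E5 E10 E9 E7 => s' E4 E5 E10 E9 E7; split=> //.
- by move=> k kn; rewrite E5; apply: Om.
- by move=> l v lL; rewrite E4 /upd cell_eq; case: ifP => // _; apply: Oa.
- by move=> v; rewrite E10 /upd num_eq; case: eqP.
- by move=> v; case: eqP => // _; apply: leqW.
- move=> v; case: eqP => [->|/eqP vx]; first by right; move: cx; rewrite Dp eqxx; lia.
  by case: (Or v) => [->|]; [left|rewrite Dp; right; lia].
- by move=> l v lo; rewrite ltn_eqF ?Ool //; apply: leq_trans (Oo x).
- move=> l v; case: (eqVneq v x) => [->|vx]; rewrite ?andbF ?andbT.
    by move=> lt lL; rewrite gtn_eqF // Of // ltnW.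
  exact: Of.
- move=> l v; case: (eqVneq v x) => [->|vx]; rewrite ?andbF ?andbT; last exact: OE.
  case: eqVneq => [-> _|lx]; first by case: pxy pE => -> H; [left|right].
  by rewrite ltnS [l <= _]leq_eqVlt (negbTE lx) /=; apply: OE.
- move=> a b ab; case: (Ov _ _ ab) => [|[l Hl]]; last first.
    right; exists l; move: Hl.
    have K1 c e : (off <= l < cn c) && (g' l c == e) ->
        (off <= l < (if c == x then (cn x).+1 else cn c)) &&
        ((if (l == cn x) && (c == x) then y else g' l c) == e).
      case: (eqVneq c x) => [->|_]; last by rewrite andbF.
      by case/andP=> /andP[-> lt]; rewrite ltn_eqF //= ltnS (ltnW lt).
    by case/orP=> /K1 ->; rewrite ?orbT.
  rewrite inE => /orP[/eqP ep|]; last by left.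
  right; exists (cn x); case: pxy => e; rewrite e in ep; case: ep => -> ->;
    by rewrite !eqxx Oo ltnSn ?orbT.
by move=> r rq; apply: Os; rewrite inE rq orbT.
Qed.

Lemma orient_step_spec s p q g' cn : oriented s (p :: q) (p :: q) g' cn ->
  (exists g'' cn', oriented (den (orient_step Dl) s) q q g'' cn') \/
  [/\ Dl < degree (p :: q) p.1, Dl < degree (p :: q) p.2 &
    oriented (den (orient_step Dl) s) (rcons q p) (rcons q p) g' cn].
Proof.
case: p => x y O; set p := (x, y).
pose s1 := set_var (set_var (set_var s 1 (nm x)) 2 (nm y)) 4 (var s 4).+1.
have [q3 q7 q8] := or_queue O.
have Q1 : queue s1 q.
  split; rewrite /= /upd /=; first by rewrite q3 /= addnS.
    by move=> i iq; rewrite addSnnS q7.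
  by move=> i iq; rewrite addSnnS q8.
have O1 : oriented s1 q (p :: q) g' cn by case: O.
have -> : den (orient_step Dl) s = den (If (Defs.Sub (Const Dl.+1) (Get 9 (Var 1))) (give 1 2)
      (If (Defs.Sub (Const Dl.+1) (Get 9 (Var 2))) (give 2 1) enqueue)) s1.
  have h7 := q7 0 isT; have h8 := q8 0 isT; rewrite addn0 /= in h7 h8.
  by rewrite /orient_step /s1; cbn [den incr eval]; rewrite /set_var /= /upd /= h7 h8 addn1.
have dg v : arr s1 9 (nm v) = degree (p :: q) v by apply: (or_deg O1).
cbn [den eval]; rewrite (_ : var s1 1 = nm x) // (_ : var s1 2 = nm y) // !dg !subn_eq0 -!ltnNge.
rewrite !ltnS; case: leqP => dx.
  by left; apply: (give_oriented O1 (x := x) (y := y)) => //; left.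
case: leqP => dy.
  by left; apply: (give_oriented O1 (x := y) (y := x)) => //; right.
right; split=> //.
have pr : perm_eq (p :: q) (rcons q p) by rewrite perm_sym perm_rcons.
apply: (oriented_perm pr).
have v1 : var s1 1 = nm x by []; have v2 : var s1 2 = nm y by []; clearbody s1.
case: O1 => Om Oa [c3 c7 c8] *; split=> //.
split; rewrite /= /upd /= ?v1 ?v2 ?c3 ?size_rcons ?addn1 ?addnS // map_rcons => i;
  rewrite ltnS leq_eqVlt nth_rcons size_map => /orP[/eqP ->|ii]; rewrite ?ltnn ?eqxx //.
  by rewrite eqn_add2l (ltn_eqF ii) ii; apply: c7.
by rewrite eqn_add2l (ltn_eqF ii) ii; apply: c8.
Qed.

Lemma sum_degree (q : seq (G * G)) : \sum_v degree q v = 2 * size q.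
Proof.
have H (f : G * G -> G) : \sum_v count (fun p => f p == v) q = size q.
  elim: q => [|p q IH] /=; first by rewrite big1.
  rewrite big_split /= IH (bigD1 (f p)) //= eqxx big1 // => v /negbTE.
  by rewrite eq_sym => ->.
by rewrite big_split /= !H mul2n addnn.
Qed.

(** A kept pair has both ends in the set [U] of vertices of degree above [Dl]. Density bounds the
    kept pairs by [K * #|U|], while the degree sum gives [4 * K * #|U| <= 2 * size q0]. The 4 in
    [Dl.+1 = 4 * K] is chosen for this halving. *)
Lemma high_halved q0 kept : uniq kept -> {subset kept <= E} ->
  (forall p, p \in kept -> Dl < degree q0 p.1 /\ Dl < degree q0 p.2) ->
  2 * size kept <= size q0.
Proof.
move=> ku kE kh; pose U := [set v | Dl < degree q0 v].
have c1 : size kept <= K * #|U|.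
  rewrite -(card_uniqP ku); apply: leq_trans (dense U).
  apply/subset_leq_card/subsetP => p pk; rewrite !inE kE //=.
  by have [-> ->] := kh p pk.
have c2 : #|U| * Dl.+1 <= 2 * size q0.
  rewrite -sum_degree -sum_nat_const [X in _ <= X](bigID (mem U)) /=.
  by apply: leq_trans (leq_addr _ _); apply: leq_sum => v; rewrite inE.
by rewrite DlK in c2; nia.
Qed.

Lemma degree_cons p q v : degree q v <= degree (p :: q) v.
Proof. by rewrite /degree /=; lia. Qed.

Lemma orient_spec s q cn : oriented s q q g cn ->
  wp (orient Dl) s ((2 * size q).+1 * 100)
    (fun s' => exists g' cn', oriented s' [::] [::] g' cn').
Proof.
move=> O0.
(* A pass over the queue started with the queue [q0]; [r] is still to be visited and
   [kept] was put back.  As a pass halves the queue, [size r + size q0] bounds the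
   number of remaining steps. *)
pose Inv m s' := exists r kept q0 g' cn', [/\ oriented s' (r ++ kept) (r ++ kept) g' cn',
  forall v, degree (r ++ kept) v <= degree q0 v,
  forall p, p \in kept -> Dl < degree q0 p.1 /\ Dl < degree q0 p.2 &
  size r + size q0 <= m].
have I0 : Inv (2 * size q) s.
  by exists q, [::], q, g, cn; rewrite cats0 mul2n addnn; split.
have step m s' : Inv m s' -> eval s' (Defs.Sub (Var 3) (Var 4)) != 0 ->
    exists2 m', m = m'.+1 & Inv m' (den (orient_step Dl) s').
  case=> r [kept [q0 [g' [cn' [O Hd Hk Hm]]]]] e0.
  have [p [r' [kept' [q1 [Er [O' Hd' Hk' Hm']]]]]] : exists p r' kept' q1,
      r ++ kept = p :: r' ++ kept' /\
      [/\ oriented s' (p :: r' ++ kept') (p :: r' ++ kept') g' cn',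
      forall v, degree (p :: r' ++ kept') v <= degree q1 v,
      forall p, p \in kept' -> Dl < degree q1 p.1 /\ Dl < degree q1 p.2 &
      size r' + size q1 < m].
    case: r => [|p r] in O Hd Hk Hm *; last by exists p, r, kept, q0.
    case: kept O Hd Hk Hm => [|p kept] O Hd Hk Hm.
      by case: (or_queue O) e0 => /= -> _ _; rewrite addn0 subnn.
    (* The pass is over, and the pairs put back form the queue of the next one. By [high_halved]
       twice their number is at most the size of the previous queue, so the measure has not grown,
       and removing [p] lowers it. *)
    exists p, kept, [::], (p :: kept); rewrite cats0; split=> //; split=> //.
    apply: leq_trans Hm; have /= := high_halved (or_uniq O) (or_sub O) Hk; lia.
  case: m Hm Hm' => // m _ Hm'; exists m => //.
  have [[g'' [cn'' O'']]|[h1 h2 O'']] := orient_step_spec O'.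
    exists r', kept', q1, g'', cn''; split=> // v.
    exact: leq_trans (degree_cons p _ v) (Hd' v).
  exists r', (rcons kept' p), q1, g', cn'; rewrite -rcons_cat; split=> //.
    move=> v; rewrite (degree_perm v (q' := p :: r' ++ kept')) //.
    exact/permPl/perm_rcons.
  move=> p'; rewrite mem_rcons inE => /orP[/eqP ->|/Hk' //].
  by split; [apply: leq_trans h1 _|apply: leq_trans h2 _]; apply: Hd'.
apply: wp_weaken (wp_while (e := Defs.Sub (Var 3) (Var 4)) _ step I0) _ _ => //.
  by rewrite leq_mul2l.
move=> s' [e0 [m [r [kept [q0 [g' [cn' [O _ _ _]]]]]]]].
exists g', cn'; suff -> : [::] = r ++ kept by [].
by case: (r ++ kept) O => // p q1 O; move: e0; case: (or_queue O) => /= -> _ _; lia.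
Qed.
End Orient.
End Programs.

(** * One level, the initialization and the succession of levels *)

Definition level_prog wts d Dl :=
  Seq (Assign 3 (Const 0)) (Seq (Assign 4 (Const 0))
  (Seq (For 5 (Put 10 (Var 5) (Const (size wts))))
  (Seq edge_scan (Seq (fork_scan wts d) (orient Dl))))).

Section LevelPrograms.
Variables (G : sgraph) (I : adjlists G) (f : nat -> nat) (L : nat).
Notation nm := (num I).
Notation n := (#|{: G}|).
Hypothesis expansion :
  forall r S H, subgraph S G -> contraction r S H -> #|edges H| <= f r * #|{: H}|.

(** Edges are pairs joined by walks without inner vertices, so [path_density] applies with
    congestion 0. *)
Lemma degree_sum_le : degree_sum I <= 2 * f 1 * n.
Proof.
have -> : degree_sum I = #|[set p : G * G | edge p.1 p.2]|.
  rewrite /degree_sum /= leqnn take_oversize ?size_map ?size_verts //.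
  rewrite sumnE big_map (perm_big _ (vertsP I)) /= big_enum /=.
  under eq_bigr => v _ do rewrite (perm_size (nbrsP I v)) -cardE -sum1_card.
  rewrite pair_big_dep /= -sum1_card; apply: eq_bigl => p; by rewrite !inE.
have := @path_density G 1 0 (f 1) setT [set p : G * G | edge p.1 p.2] (fun=> [::]) (expansion (r := 1)).
rewrite add0n mul0n addn0 mul1n cardsT; apply=> [e|e|[a b]|//|z].
- by rewrite !inE.
- by rewrite inE /= => ->.
- by rewrite inE; apply: contraTneq => /= ->; rewrite edge_irrefl.
by rewrite leqn0 cards_eq0; apply/eqP/setP => e; rewrite !inE andbF.
Qed.

(** The interface between consecutive levels. Marked pairs are already joined, so skipping them
    loses no fork; the degrees are back to zero, ready for an empty queue. The edges are rescanned
    at every level, but after the first they are all marked. *)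
Record ready d wts c g mk s : Prop := Ready {
  rd_inputs : inputs I s;
  rd_mult : multiples G L s;
  rd_arcs : arcs_at I L s g;
  rd_linv : linv d wts c g;
  rd_free : forall l v, size wts <= l < L -> g l v = v;
  rd_marks : marks I s mk;
  rd_joined : forall a b, mk (a, b) -> joined wts g d a b;
  rd_deg : degrees I s [::] }.

Definition level_time wts d K :=
  1000 + 200 * f 1 + 2 * bcost (seqs [seq fork_cmd p.1 p.2 | p <- fork_pairs wts d]) + 200 * K.

Lemma fork_scan_frame wts d s s' : frame (fork_scan wts d) s s' ->
  (forall x, x \notin [:: 5; 1; 2; 3] -> var s' x = var s x) /\
  (forall a, a \notin [:: 6; 7; 8; 9] -> arr s' a = arr s a).
Proof. by apply/frame_for/writes_in_seqs => p _; apply: fork_cmd_writes. Qed.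

Lemma level_prog_spec d wts c g mk s K Dl : ready d wts c g mk s ->
  K = (level_density f d.+1 wts c).+1 -> Dl.+1 = 4 * K -> size wts + Dl <= L ->
  wp (level_prog wts d.+1 Dl) s (level_time wts d.+1 K * n.+1) (fun s' => exists g' mk',
    ready d.+1 (wts ++ nseq Dl d.+1) (c + Dl * (2 * congestion wts c)) g' mk' s').
Proof.
case=> Ri Rm Ra Rl Rf Rk Rj Rd KE DE DL.
have dsum := degree_sum_le.
pose R a b := edge a b \/ fork wts g d.+1 a b.
pose B := bcost (seqs [seq fork_cmd p.1 p.2 | p <- fork_pairs wts d.+1]).
apply: (wp_weaken (T := (1 + (1 + ((n.+1 * 20).*2 + (100 * (n + degree_sum I).+1 +
  ((n.+1 * (B + 10)).*2 + (2 * (K * n)).+1 * 100).+1).+1).+1).+2).+2)); last 2 first.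
- rewrite /level_time -/B; nia.
- exact: (fun s' H => H).
apply: wp_assign_seq; apply: wp_assign_seq; set s1 := set_var _ _ _.
pose Inv i s' := forall v, nm v < i -> arr s' 10 (nm v) = size wts.
have H0 : wp (For 5 (Put 10 (Var 5) (Const (size wts)))) s1 (n.+1 * 20).*2 (Inv n).
  apply: wp_weaken (wp_for (Inv := Inv) (n := n) _ _ _ _ _ _) _ _ => //.
  - by case: Ri.
  - move=> i s' _ _ v5 Hi v; rewrite ltnS leq_eqVlt /= /upd /= v5.
    by case: eqP => // _ /= /Hi.
  by rewrite leq_double leq_mul2l.
apply: wp_seq (wp_frame H0) _ => s2 [cn2 [fv2 fa2]].
have C2 : collected I L mk R s2 [::].
  split=> //.
  - by move=> j jn; rewrite fa2 //; apply: Rm.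
  - by split=> //; rewrite !fv2.
  - by move=> v; rewrite fa2 //; apply: Rd.
  by move=> a b; rewrite fa2 // orbF; apply: Rk.
have I2 : inputs I s2 by case: Ri => i0 i1 i2; split; rewrite ?fv2 ?fa2.
have H3 := edge_scan_spec C2 I2 (fun a b H => or_introl H).
apply: wp_seq (wp_frame H3) _ => s3 [[q3 [C3 _ E3]] [fv3 fa3]].
have I3 : inputs I s3 by case: I2 => i0 i1 i2; split; rewrite ?fv3 ?fa3.
have A3 : arcs_at I L s3 g by move=> l v lL; rewrite fa3 // fa2 // Ra.
have cn3 v : arr s3 10 (nm v) = size wts by rewrite fa3 // cn2 ?num_lt.
have wL : size wts <= L by apply: leq_trans DL; apply: leq_addr.
have [v03 _ _] := I3.
have H4 := fork_scan_spec C3 A3 wL v03 (fun a b H => or_intror H).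
apply: wp_seq (wp_frame H4) _ => s4 [[q [C4 q34 E4]] /fork_scan_frame[fv4 fa4]].
pose E := [set p | p \in q].
have E_sound a b : (a, b) \in E -> a != b /\ (edge a b \/ fork wts g d.+1 a b).
  by rewrite inE => /(coll_R C4).
have dense (U : {set G}) : #|[set e in E | (e.1 \in U) && (e.2 \in U)]| <= K * #|U|.
  apply: leq_trans (level_dense Rl E_sound expansion U) _.
  by rewrite KE leq_mul2r leqnSn orbT.
have sq : size q <= K * n.
  rewrite -(card_uniqP (coll_uniq C4)) -cardsT; apply: leq_trans (dense setT).
  by apply/subset_leq_card/subsetP => p pq; rewrite !inE pq.
have O4 : oriented I L (size wts) Dl E g s4 q q g (fun=> size wts).
  case: (C4) => cm cq cd ck cu cR; split=> //.
  - by move=> l v lL; rewrite fa4 // A3.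
  - by move=> v; rewrite fa4 // cn3.
  - by move=> v; left.
  - by move=> l v l1 l2; rewrite Rf // l1.
  - by move=> l v; rewrite leqNgt; case: ltnP.
  - by move=> a b; rewrite inE; left.
  by move=> p pq; rewrite inE.
have H5 := orient_spec DL DE (fun a b H => (E_sound a b H).1) dense O4.
apply: wp_weaken (wp_frame H5) _ _ => [|s5 [[g' [cn' O5]] [fv5 fa5]]].
  by rewrite leq_mul2r /= ltnS leq_mul2l sq.
have {O4 H5} [Om Oa Oq Od Oc Oo Or Ool Of OE Ov _ _] := O5.
have cnD v : cn' v <= size wts + Dl by case: (Or v) => [->|]; [apply: leq_addr|apply: leq_trans (leq_addr _ _)].
have cover a b : (a, b) \in E ->
    exists2 l, size wts <= l < size wts + Dl & g' l a = b \/ g' l b = a.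
  case/Ov => [//|[l Hl]]; exists l; case/orP: Hl => /andP[/andP[h1 h2] /eqP h3]; rewrite ?h1 ?h3.
  - exact: leq_trans h2 (cnD a).
  - exact: leq_trans h2 (cnD b).
  - by left.
  by right.
have mkE p : mk p || (p \in q) -> joined (wts ++ nseq Dl d.+1) g' d.+1 p.1 p.2.
  case: p => a b /orP[/Rj H|pq].
    by apply: (joined_leq (leqnSn d)); apply: joined_extend H.
  by apply/joined_new/cover; rewrite inE.
have ESj (a b : G) : mk (a, b) || ((a, b) \in q) -> (a, b) \in E \/ joined wts g d a b.
  by case/orP=> [/Rj|]; [right|left; rewrite inE].
exists g', (fun p => mk p || (p \in q)); split=> //.
- by case: I3 => i0 i1 i2; split; rewrite ?fv5 ?fa5 // ?fv4 ?fa4.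
- apply: (level_step (g := g) (E := E)) => //.
  + by move=> a b /E4/ESj[]; [left|right; apply: joined_leq (leqnSn d) _].
  + move=> d0 a b /E3 ab; have [|h|h] := ESj a b; [|by left|].
      by case/orP: ab => [->//|/q34 ->]; rewrite orbT.
    by right; apply: joined_leq h; rewrite d0.
  + move=> l v /andP[l1 l2] gv; apply: OE; rewrite l1 ltnNge; apply: contra gv => cl.
    by rewrite Of //; apply: leq_trans DL.
- move=> l v; rewrite size_cat size_nseq => /andP[l1 l2].
  by rewrite Of //; apply: leq_trans l1.
- by move=> a b; rewrite fa5 // (coll_marks C4).
by move=> a b /mkE.
Qed.
End LevelPrograms.

(** The loop tabulates the multiples of [n] up to index [n], the unrolled commands up to index [L],
    which is larger for small graphs. The last loop makes every letter the identity, that is,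
    removes all arcs. *)
Definition init_prog L :=
  Seq (For 5 (Put 5 (Add (Var 5) (Const 1)) (Add (Get 5 (Var 5)) (Var 0))))
  (Seq (seqs [seq Put 5 (Const i.+1) (Add (Get 5 (Const i)) (Var 0)) | i <- iota 0 L])
  (For 5 (seqs [seq Put 4 (letter_at (Const l) (Var 5)) (Var 5) | l <- iota 0 L]))).

Definition init_time L :=
  1000 + bcost (seqs [seq Put 5 (Const i.+1) (Add (Get 5 (Const i)) (Var 0)) | i <- iota 0 L])
    + 2 * bcost (seqs [seq Put 4 (letter_at (Const l) (Var 5)) (Var 5) | l <- iota 0 L]).

Section InitProgram.
Variables (G : sgraph) (I : adjlists G) (L : nat).
Notation nm := (num I).
Notation n := (#|{: G}|).

Lemma linv0 : linv 0 [::] 0 (fun _ (v : G) => v).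
Proof.
split=> [|s a b _ [l [l' [v [//]]]]|//].
by exists (fun _ _ => [::]) => // z; rewrite big_geq.
Qed.

Lemma init_prog_spec :
  wp (init_prog L) (input I) (init_time L * n.+1) (fun s =>
    ready I L 0 [::] 0 (fun _ v => v) xpred0 s /\
    forall a, a \in [:: 2; 3; 11; 12; 13; 14] -> forall i, arr s a i = 0).
Proof.
set B1 := bcost (seqs [seq Put 5 (Const i.+1) (Add (Get 5 (Const i)) (Var 0)) | i <- iota 0 L]).
set B2 := bcost (seqs [seq Put 4 (letter_at (Const l) (Var 5)) (Var 5) | l <- iota 0 L]).
apply: (wp_weaken (T := ((n.+1 * 20).*2 + (B1 + (n.+1 * (B2 + 10)).*2).+1).+1)); last 2 first.
- by rewrite /init_time -/B1 -/B2; nia.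
- exact: (fun s' H => H).
pose Inv1 i s := forall j, j <= i -> arr s 5 j = j * n.
have v0 : var (input I) 0 = n by [].
have H1 : wp (For 5 (Put 5 (Add (Var 5) (Const 1)) (Add (Get 5 (Var 5)) (Var 0)))) (input I)
    (n.+1 * 20).*2 (Inv1 n).
  apply: wp_weaken (wp_for (Inv := Inv1) (n := n) _ _ _ v0 _ _) _ _ => //.
  - by case.
  - move=> i s _ [Fv _] v5 Hi j; rewrite /= /upd /= v5 addn1 leq_eqVlt ltnS.
    by case: eqP => [-> _|_ /Hi //]; rewrite Hi // Fv // v0 mulSn addnC.
  by rewrite leq_double leq_mul2l.
apply: wp_seq (wp_frame H1) _ => s1 [M1 [fv1 fa1]].
have lf1 k m : loop_free (seqs [seq Put 5 (Const i.+1) (Add (Get 5 (Const i)) (Var 0)) | i <- iota m k]).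
  by rewrite loop_free_seqs all_map; apply/allP.
have W1 k m : writes_in [::] [:: 5] (seqs [seq Put 5 (Const i.+1) (Add (Get 5 (Const i)) (Var 0)) | i <- iota m k]).
  by apply: writes_in_seqs => p _; split.
pose Q s := var s 0 = n /\ forall j, (j <= n) || (j <= L) -> arr s 5 j = j * n.
have H2 : wp (seqs [seq Put 5 (Const i.+1) (Add (Get 5 (Const i)) (Var 0)) | i <- iota 0 L]) s1 B1 Q.
  apply: wp_den => //.
  suff H k m s0 : var s0 0 = n -> (forall j, (j <= n) || (j <= m) -> arr s0 5 j = j * n) ->
      let s' := den (seqs [seq Put 5 (Const i.+1) (Add (Get 5 (Const i)) (Var 0)) | i <- iota m k]) s0 in
      var s' 0 = n /\ forall j, (j <= n) || (j <= m + k) -> arr s' 5 j = j * n.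
    apply: (H L 0); first by rewrite fv1.
    by move=> j /orP[/M1 //|]; rewrite leqn0 => /eqP ->; apply: M1.
  elim: k m s0 => [|k IH] m s0 w0 Hm /=; first by rewrite addn0.
  rewrite -addSnnS; apply: IH => // j; rewrite /= /upd /=.
  rewrite [j <= m.+1]leq_eqVlt ltnS; case: eqP => [-> _|_ /= /Hm //].
  by rewrite Hm ?leqnn ?orbT // w0 mulSn addnC.
apply: wp_seq (wp_frame H2) _ => s2 [[w0 M2] [fv2 fa2]].
have {fv2 fa2 W1} [fv2 fa2] : (forall x, var s2 x = var s1 x) /\
    (forall a, a != 5 -> arr s2 a = arr s1 a).
  have [Wv Wa] := W1 L 0.
  split=> x; first by apply: fv2; apply/negP => /Wv.
  by move=> x5; apply: fa2; apply/negP => /Wa; rewrite inE (negbTE x5).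
pose Inv3 i s := multiples G L s /\
  forall l v, l < L -> nm v < i -> arr s 4 (l * n + nm v) = nm v.
have W3 ls : writes_in [::] [:: 4] (seqs [seq Put 4 (letter_at (Const l) (Var 5)) (Var 5) | l <- ls]).
  by apply: writes_in_seqs => p _; split.
have lf3 ls : loop_free (seqs [seq Put 4 (letter_at (Const l) (Var 5)) (Var 5) | l <- ls]).
  by rewrite loop_free_seqs all_map; apply/allP.
have H3 : wp (For 5 (seqs [seq Put 4 (letter_at (Const l) (Var 5)) (Var 5) | l <- iota 0 L])) s2
    (n.+1 * (B2 + 10)).*2 (Inv3 n).
  have [Wv Wa] := W3 (iota 0 L).
  apply: wp_for => //.
  - by apply/negP; rewrite inE /= => /Wv.
  - by apply/negP => /Wv.
  - by split=> // j; move=> jn; apply: M2; case/orP: jn => /ltnW ->; rewrite ?orbT.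
  move=> i s iN _ v5 [Mi Hi]; have [v vi] := num_surj I iN.
  rewrite -vi in v5.
  suff H ls (P : nat -> G -> Prop) s' : {subset ls <= iota 0 L} -> multiples G L s' ->
      var s' 5 = nm v -> (forall l u, l < L -> P l u -> arr s' 4 (l * n + nm u) = nm u) ->
      let s'' := den (seqs [seq Put 4 (letter_at (Const l) (Var 5)) (Var 5) | l <- ls]) s' in
      multiples G L s'' /\ forall l u, l < L -> P l u \/ (l \in ls /\ u = v) ->
        arr s'' 4 (l * n + nm u) = nm u.
    have [|M' H'] := H (iota 0 L) (fun _ u => nm u < i) s (fun l H => H) Mi v5.
      by move=> l u lL ui; apply: Hi.
    split; first exact: M'.
    move=> l u lL; rewrite ltnS leq_eqVlt -vi num_eq => /orP[/eqP ->|ui].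
      by apply: H' => //; right; rewrite mem_iota.
    by apply: H' => //; left; rewrite -vi.
  elim: ls P s' => [|k ls IH] P s' sub M' v5' HP; first by split=> // l u lL [/HP -> //|[]].
  have kL : k < L by have := sub k (mem_head _ _); rewrite mem_iota.
  rewrite /=; set s1' := set_arr _ _ _ _.
  have E4 : arr s1' 4 = upd (arr s' 4) (k * n + nm v) (nm v).
    by rewrite /s1' /= /upd /= v5' M' // kL orbT.
  have [||||M'' H''] := IH (fun l u => P l u \/ (l = k /\ u = v)) s1'.
  - by move=> l ll; apply: sub; rewrite inE ll orbT.
  - by [].
  - by [].
  - move=> l u lL HH; rewrite E4 /upd cell_eq; case: eqP => [_ /=|lk /=].
      by case: eqP => [-> //|uv]; case: HH => [/HP -> //|[_ /uv]].
    by case: HH => [/HP -> //|[/lk]].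
  split=> // l u lL HH; apply: H'' => //.
  case: HH => [|[]]; first by left; left.
  by rewrite inE => /orP[/eqP -> ->|ll ->]; [left; right|right].
apply: wp_weaken (wp_frame H3) (leqnn _) _ => s3 [[M3 H4] [fv3 fa3]].
have {}fa3 a : a != 4 -> arr s3 a = arr s2 a.
  move=> a4; apply: fa3; rewrite [warrs _]/= cats0; apply/negP => /(W3 _).2.
  by rewrite inE (negbTE a4).
have {}fv3 x : x != 5 -> var s3 x = var s2 x.
  move=> x5; apply: fv3; rewrite [wvars _]/= in_cons mem_cat inE (negbTE x5) orbF /=.
  by apply/negP => /(W3 _).1.
split; last by move=> a /[dup] aa; rewrite !inE => H i; rewrite fa3 ?fa2 ?fa1 //;
  move: H; do ![case: eqP => [->|_] //=].
split=> //.
- by split; rewrite ?fv3 ?fa3 // ?fv2 ?fa2 // ?fv1 ?fa1.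
- by move=> l v lL; apply: H4 => //; apply: num_lt.
- exact: linv0.
- by move=> a b; rewrite fa3 // fa2 // fa1.
by move=> v; rewrite fa3 // fa2 // fa1.
Qed.
End InitProgram.

Lemma level_prog_writes wts d Dl : {subset warrs (level_prog wts d Dl) <= [:: 4; 6; 7; 8; 9; 10]}.
Proof.
have : {subset warrs (fork_scan wts d) <= [:: 6; 7; 8; 9]}.
  rewrite /fork_scan [warrs _]/= cats0.
  have [] // := @writes_in_seqs _ (fun p => fork_cmd p.1 p.2) (fork_pairs wts d) [:: 1; 2; 3] [:: 6; 7; 8; 9].
  by move=> p _; apply: fork_cmd_writes.
rewrite /level_prog; move: (fork_scan _ _) => F HF a; rewrite /= !in_cons mem_cat !in_cons.
have := HF a; rewrite !inE => {}HF H; move: HF; case: (a \in warrs F) H => [_ /(_ isT)|H _]; first by lia.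
by lia.
Qed.

Section Levels.
Variable f : nat -> nat.

(* The weights of the letters of the first [d] levels, and a bound on the congestion of their arcs. *)
Fixpoint params d : seq nat * nat :=
  if d is d'.+1 then
    let: (wts, c) := params d' in
    let Dl := (4 * (level_density f d wts c).+1).-1 in
    (wts ++ nseq Dl d, c + Dl * (2 * congestion wts c))
  else ([::], 0).

(** The predecessor of [4 * K], as the orientation demands, where [K] is the density plus one in
    order to be positive. *)
Definition level_width d := (4 * (level_density f d.+1 (params d).1 (params d).2).+1).-1.

Fixpoint levels d :=
  if d is d'.+1 then Seq (levels d') (level_prog (params d').1 d (level_width d')) else Skip.

Fixpoint levels_time d :=
  if d is d'.+1 then
    (levels_time d' + level_time f (params d').1 d (level_density f d (params d').1 (params d').2).+1).+1
  else 1.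

Lemma paramsS d : params d.+1 = ((params d).1 ++ nseq (level_width d) d.+1,
  (params d).2 + level_width d * (2 * congestion (params d).1 (params d).2)).
Proof. by rewrite /level_width /=; case: (params d). Qed.

Lemma params_size d d' : d <= d' -> size (params d).1 <= size (params d').1.
Proof.
elim: d' => [|d' IH]; first by rewrite leqn0 => /eqP ->.
rewrite leq_eqVlt ltnS => /orP[/eqP -> //|/IH H]; rewrite paramsS size_cat.
exact: leq_trans H (leq_addr _ _).
Qed.

Lemma params_pos d : all (leq 1) (params d).1.
Proof. by elim: d => // d IH; rewrite paramsS all_cat IH all_nseq orbT. Qed.

(** The letters of all [m] levels are allocated before the first one, hence [size (params m).1] at
    every [d]. *)
Lemma levels_spec (G : sgraph) (I : adjlists G) m :
  (forall r S H, subgraph S G -> contraction r S H -> #|edges H| <= f r * #|{: H}|) ->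
  forall d s, d <= m -> ready I (size (params m).1) 0 [::] 0 (fun _ v => v) xpred0 s ->
  wp (levels d) s (levels_time d * #|{: G}|.+1) (fun s' => exists g mk,
    ready I (size (params m).1) d (params d).1 (params d).2 g mk s' /\
    forall a, a \notin [:: 4; 6; 7; 8; 9; 10] -> arr s' a = arr s a).
Proof.
move=> ex; elim=> [|d IH] s dm rd.
  apply: (wp_weaken (T := 1)); first exact: (wp_den (c := Skip) (Q := eq s)).
    by rewrite mul1n.
  by move=> _ <-; exists (fun _ v => v), xpred0.
apply: (wp_weaken (T := (levels_time d * #|{: G}|.+1 +
  level_time f (params d).1 d.+1 (level_density f d.+1 (params d).1 (params d).2).+1 * #|{: G}|.+1).+1)); last 2 first.
- by rewrite [levels_time d.+1]/= mulSn mulnDl addSn ltnS leq_addl.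
- exact: (fun s' H => H).
apply: wp_seq (IH s (ltnW dm) rd) _ => s1 [g [mk [rd1 fr]]].
  have DL : size (params d).1 + level_width d <= size (params m).1.
    by have := params_size dm; rewrite paramsS size_cat size_nseq.
  have DE : (level_width d).+1 = 4 * (level_density f d.+1 (params d).1 (params d).2).+1.
    by rewrite /level_width prednK // muln_gt0.
  apply: wp_weaken (wp_frame (level_prog_spec ex rd1 (erefl _) DE DL)) (leqnn _) _.
  move=> s2 [[g' [mk' rd2]] [_ fa]]; exists g', mk'; rewrite paramsS; split=> // a an.
  rewrite -fr //; apply: fa.
by apply: contra an; apply: level_prog_writes.
Qed.
End Levels.

(** * Choosing the two sets *)

(** A word is compiled into a nested lookup, so a hub is computed by one expression of constant
    cost. *)
Definition word_expr := foldl (fun e l => Get 4 (letter_at (Const l) e)) (Var 5).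
Definition owner_expr w := Get 2 (word_expr w).

Definition owned_test ws := seqs [seq If (owner_expr w) (Assign 7 (Const 1)) Skip | w <- ws].
Definition claim ws := seqs [seq Put 2 (word_expr w) (Add (Var 5) (Const 1)) | w <- ws].
Definition dominate_body ws := Seq (Assign 7 (Const 0)) (Seq (owned_test ws)
  (If (Var 7) Skip (Seq (Put 11 (Var 5) (Const 1)) (claim ws)))).
Definition dominate ws := For 5 (dominate_body ws).

(* Arrays 12, 13 and 14 are indexed by the contents of array 2, that is, by
   [num I v + 1]; index 0 stands for "no owner" and its cell is never read. *)
Definition count_in ws := seqs [seq incr_at 12 (owner_expr w) | w <- ws].
Definition count_body ws := If (Get 11 (Var 5)) (count_in ws) Skip.
Definition count_indeg ws := For 5 (count_body ws).

Definition selected_test ws := seqs [seq If (Get 14 (owner_expr w)) (Assign 7 (Const 1)) Skip | w <- ws].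
Definition block ws := seqs [seq Put 13 (owner_expr w) (Const 1) | w <- ws].
(** Conflicts are directed and must be tested both ways: array 13 marks the owners of hubs of the
    chosen vertices, and [selected_test] looks for chosen owners among the hubs of the candidate. *)
Definition select_body ws :=
  If (Get 11 (Var 5))
    (If (Defs.Sub (Const (2 * size ws).+1) (Get 12 (Add (Var 5) (Const 1))))
      (If (Get 13 (Add (Var 5) (Const 1))) Skip
        (Seq (Assign 7 (Const 0)) (Seq (selected_test ws)
          (If (Var 7) Skip
            (Seq (Put 3 (Var 5) (Const 1)) (Seq (Put 14 (Add (Var 5) (Const 1)) (Const 1)) (block ws)))))))
      Skip) Skip.
Definition select ws := For 5 (select_body ws).

Lemma dominate_body_writes ws : writes_in [:: 7] [:: 2; 11] (dominate_body ws).
Proof.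
have [v1 a1] : writes_in [:: 7] [:: 2; 11] (owned_test ws) by apply: writes_in_seqs => w _; split.
have [v2 a2] : writes_in [:: 7] [:: 2; 11] (claim ws).
  by apply: writes_in_seqs => w _; split=> // a; rewrite !inE => ->.
split=> x; rewrite /= ?in_cons ?mem_cat ?in_cons.
  by case/or3P => [/eqP ->|/v1|/v2].
by case/or3P => [/a1|/eqP ->|/a2].
Qed.

Lemma count_body_writes ws : writes_in [::] [:: 12] (count_body ws).
Proof.
have [v1 a1] : writes_in [::] [:: 12] (count_in ws).
  by apply: writes_in_seqs => w _; split.
by split=> x; rewrite /= cats0; [apply: v1|apply: a1].
Qed.

Lemma select_body_writes ws : writes_in [:: 7] [:: 3; 13; 14] (select_body ws).
Proof.
have [v1 a1] : writes_in [:: 7] [:: 3; 13; 14] (selected_test ws) by apply: writes_in_seqs => w _; split.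
have [v2 a2] : writes_in [:: 7] [:: 3; 13; 14] (block ws).
  by apply: writes_in_seqs => w _; split=> // a; rewrite !inE => /eqP ->.
split=> x; rewrite /= ?cats0 ?in_cons ?mem_cat ?in_cons.
  by case/or3P => [/eqP ->|/v1|/v2].
by case/or4P => [/a1|/eqP ->|/eqP ->|/a2].
Qed.

Section Greedy.
Variables (G : sgraph) (I : adjlists G) (wts : seq nat) (g : nat -> G -> G).
Notation nm := (num I).
Notation n := (#|{: G}|).
Notation L := (size wts).

Definition at_vertex s v := [/\ multiples G L s, arcs_at I L s g & var s 5 = nm v].

Lemma at_vertex_frame s s' v : at_vertex s v -> arr s' 4 = arr s 4 -> arr s' 5 = arr s 5 ->
  var s' 5 = var s 5 -> at_vertex s' v.
Proof.
case=> M A v5 e4 e5 ev; split; last by rewrite ev.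
  by move=> j jn; rewrite e5 M.
by move=> l u lL; rewrite e4 A.
Qed.

Lemma eval_word s v w : at_vertex s v -> word wts w -> eval s (word_expr w) = nm (hub g w v).
Proof.
case=> M A v5; rewrite /word_expr /hub.
elim/last_ind: w => [|w l IH] //; rewrite /word all_rcons => /andP[ll /IH E].
by rewrite -cats1 !foldl_cat /= E M ?ll ?orbT // A.
Qed.

Lemma test_spec (F : seq nat -> expr) (cond : seq nat -> nat) s v ws :
  at_vertex s v ->
  (forall s' w, at_vertex s' v -> arr s' = arr s -> w \in ws -> eval s' (F w) = cond w) ->
  let s' := den (seqs [seq If (F w) (Assign 7 (Const 1)) Skip | w <- ws]) s in
  [/\ arr s' = arr s, forall x, x != 7 -> var s' x = var s x &
    (var s' 7 != 0) = (var s 7 != 0) || has (fun w => cond w != 0) ws].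
Proof.
elim: ws s => [|w ws IH] s av HF; first by rewrite /= orbF.
rewrite [den _ _]/= (HF s w) ?mem_head // [has _ _]/=.
have HF' s1 s' w' : arr s1 = arr s -> at_vertex s' v -> arr s' = arr s1 -> w' \in ws -> eval s' (F w') = cond w'.
  by move=> e1 a1 e2 ww; apply: HF; rewrite ?e2 ?inE ?ww ?orbT.
case: ifP => /= c0; last by have [|a1 a2 a3] := IH s av; [move=> *; apply: (HF' s)|split].
have [||a1 a2 a3] := IH (set_var s 7 1).
- exact: at_vertex_frame av _ _ _.
- by move=> s' w' h1 h2 h3; apply: (HF' (set_var s 7 1)).
split=> //; first by move=> x x7; rewrite a2 //= /upd (negbTE x7).
by rewrite a3 orbT.
Qed.

Lemma claim_spec s v ws : at_vertex s v -> all (word wts) ws ->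
  let s' := den (claim ws) s in
  [/\ var s' = var s, forall a, a != 2 -> arr s' a = arr s a &
    forall x, arr s' 2 (nm x) = if x \in [seq hub g w v | w <- ws] then (nm v).+1 else arr s 2 (nm x)].
Proof.
rewrite /claim; elim: ws s => [|w ws IH] s av; first by [].
case/andP=> ww wws; rewrite [den _ _]/= (eval_word av ww).
have v5 : var s 5 = nm v by case: av.
set s1 := set_arr _ _ _ _.
have [|//|a1 a2 a3] := IH s1; first exact: at_vertex_frame av _ _ _.
split; first by rewrite a1.
  by move=> a an; rewrite a2 //= /upd (negbTE an).
move=> x; rewrite a3 inE /= /upd /= num_eq v5 addn1.
by case: (x \in _); rewrite ?orbT ?orbF.
Qed.

Section Dominate.
Variable ws : seq (seq nat).
Hypothesis wsP : all (word wts) ws.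

Record dominated i s : Prop := Dominated {
  dm_own : forall x, arr s 2 (nm x) != 0 -> exists v, [/\ arr s 2 (nm x) = (nm v).+1,
    arr s 11 (nm v) != 0 & exists2 w, w \in ws & hub g w v = x];
  dm_hub : forall v w, arr s 11 (nm v) != 0 -> w \in ws -> arr s 2 (nm (hub g w v)) = (nm v).+1;
  dm_not : forall v, nm v < i -> arr s 11 (nm v) = 0 ->
    exists2 w, w \in ws & arr s 2 (nm (hub g w v)) != 0 }.

Lemma dominate_spec s : var s 0 = n -> multiples G L s -> arcs_at I L s g ->
  (forall i, arr s 2 i = 0) -> (forall i, arr s 11 i = 0) ->
  wp (dominate ws) s (n.+1 * (bcost (dominate_body ws) + 10)).*2
   (fun s' => dominated n s' /\ frame (dominate ws) s s').
Proof.
move=> v0 M A z2 z11; rewrite /dominate; set body := dominate_body ws.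
have lf : loop_free body.
  by rewrite /body /= /owned_test /claim !loop_free_seqs !all_map; apply/andP; split; apply/allP.
have [Wv Wa] := dominate_body_writes ws; rewrite -/body in Wv Wa.
apply/wp_frame/(wp_for (Inv := dominated)) => //.
- by apply/negP; rewrite inE /= => /Wv.
- by apply/negP => /Wv.
- by split=> [x|v w|v] /=; rewrite ?z2 ?z11.
move=> i s1 iN [fv fa] v5 D; have [v vi] := num_surj I iN.
have av : at_vertex s1 v.
  split; last by rewrite v5.
    by move=> j jn; rewrite fa ?M // [warrs _]/= cats0; apply/negP => /Wa.
  by move=> l u lL; rewrite fa ?A // [warrs _]/= cats0; apply/negP => /Wa.
have [//||t1 t2 t3] := @test_spec owner_expr (fun w => arr s1 2 (nm (hub g w v))) (set_var s1 7 0) v ws.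
  move=> s2 w a2 e2 ww; rewrite /= (eval_word a2) ?e2 //; exact: (allP wsP).
rewrite /body /dominate_body; cbn [den]; rewrite -/(owned_test ws) in t1 t2 t3.
move: (den (owned_test ws) _) t1 t2 t3 => s2 t1 t2 t3.
have v52 : var s2 5 = nm v by rewrite t2 //= /upd /= v5.
have av2 : at_vertex s2 v by apply: at_vertex_frame av _ _ _; rewrite ?t1 ?v52 ?v5.
rewrite [eval s2 _]/= t3 (_ : var (set_var s1 7 0) 7 = 0) //=.
case: D => D1 D2 D3; case: hasP => [[w ww hw]|hn].
  split; rewrite /= ?t1 //.
  move=> u; rewrite ltnS leq_eqVlt -vi num_eq => /orP[/eqP ->|ui] u0; last by apply: D3 => //; rewrite -vi.
  by exists w.
rewrite v52; set s3 := set_arr _ _ _ _.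
have [|//|c1 c2 c3] := @claim_spec s3 v ws; first exact: at_vertex_frame av2 _ _ _.
move: (den _ s3) c1 c2 c3 => s4 c1 c2 c3.
have E11 u : arr s4 11 (nm u) = if u == v then 1 else arr s1 11 (nm u).
  by rewrite c2 //= /upd /= num_eq t1.
have E2 x : arr s4 2 (nm x) = if x \in [seq hub g w v | w <- ws] then (nm v).+1 else arr s1 2 (nm x).
  by rewrite c3 /= /upd /= t1.
have free w : w \in ws -> arr s1 2 (nm (hub g w v)) = 0.
  by move=> ww; apply/eqP; apply/negPn/negP => H; apply: hn; exists w.
split; rewrite [arr _]/=.
- move=> x; rewrite E2; case: ifP => [/mapP[w ww ->] _|_ /D1 [u [u1 u2 u3]]].
    by exists v; rewrite E11 eqxx; split=> //; exists w.
  exists u; rewrite E11; split=> //; by case: (u == v).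
- move=> u w; rewrite E11; case: (eqVneq u v) => [->|uv] u0 ww; first by rewrite E2 (map_f (fun w => hub g w v) ww).
  (* No earlier claim is overwritten: [v] claims its hubs only when all of them are free, while a
     hub of [u] was already owned. *)
  rewrite E2 D2 //; case: ifP => // /mapP[w' ww' e].
  by have := free w' ww'; rewrite -e D2.
move=> u; rewrite ltnS leq_eqVlt -vi num_eq E11; case: (eqVneq u v) => //= _ ui u0.
have [|//|w ww h] := D3 u; first by rewrite -vi.
by exists w => //; rewrite E2; case: ifP.
Qed.
End Dominate.

Section Select.
Variables (own : G -> option G) (P : {set G}) (ws : seq (seq nat)).
Hypothesis wsP : all (word wts) ws.

Definition ownership s :=
  (forall x, arr s 2 (nm x) = if own x is Some v then (nm v).+1 else 0) /\
  (forall v, (arr s 11 (nm v) != 0) = (v \in P)).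

Lemma ownership_frame s s' : ownership s -> arr s' 2 = arr s 2 -> arr s' 11 = arr s 11 -> ownership s'.
Proof. by case=> h1 h2 e1 e2; split=> x; rewrite ?e1 ?e2. Qed.

Lemma owner_hit s u w v : ownership s ->
  (arr s 2 (nm (hub g w u)) == (nm v).+1) = (own (hub g w u) == Some v).
Proof.
case=> -> _; case: (own _) => [x|//].
by rewrite eqSS num_eq (inj_eq Some_inj).
Qed.

Lemma count_in_spec s u rs : at_vertex s u -> ownership s -> all (word wts) rs ->
  let s' := den (count_in rs) s in
  [/\ var s' = var s, forall a, a != 12 -> arr s' a = arr s a &
    forall v, arr s' 12 (nm v).+1 = arr s 12 (nm v).+1 + conflicts g own rs u v].
Proof.
rewrite /count_in /conflicts; elim: rs s => [|w rs IH] s au os.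
  by split=> // v; rewrite addn0.
case/andP=> ww wrs; rewrite [den _ _]/= (eval_word au ww).
set s1 := set_arr _ _ _ _.
have au1 : at_vertex s1 u by apply: at_vertex_frame au _ _ _.
have os1 : ownership s1 by apply: ownership_frame os _ _.
have [a1 a2 a3] := IH s1 au1 os1 wrs.
split; first by rewrite a1.
  by move=> a an; rewrite a2 //= /upd (negbTE an).
move=> v; rewrite a3 /= /upd /= [_.+1 == _]eq_sym (owner_hit _ _ _ os).
case: eqP => [e|_]; last by rewrite add0n.
by rewrite os.1 e addn1 addSnnS.
Qed.

Lemma block_spec s u rs : at_vertex s u -> ownership s -> all (word wts) rs ->
  let s' := den (block rs) s in
  [/\ var s' = var s, forall a, a != 13 -> arr s' a = arr s a &
    forall v, (arr s' 13 (nm v).+1 != 0) = (arr s 13 (nm v).+1 != 0) || (0 < conflicts g own rs u v)].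
Proof.
rewrite /block /conflicts; elim: rs s => [|w rs IH] s au os.
  by split=> // v; rewrite orbF.
case/andP=> ww wrs; rewrite [den _ _]/= (eval_word au ww).
set s1 := set_arr _ _ _ _.
have au1 : at_vertex s1 u by apply: at_vertex_frame au _ _ _.
have os1 : ownership s1 by apply: ownership_frame os _ _.
have [a1 a2 a3] := IH s1 au1 os1 wrs.
split; first by rewrite a1.
  by move=> a an; rewrite a2 //= /upd (negbTE an).
move=> v; rewrite a3 /= /upd /= [_.+1 == _]eq_sym (owner_hit _ _ _ os).
by case: (_ == Some v) => /=; rewrite ?add0n ?orbT.
Qed.

(** A hub without owner makes the test look at cell 0 of array 14, hence the assumption that this
    cell is 0. *)
Lemma conflict_test s u : ownership s -> forall t : G -> bool,
  (forall v, (arr s 14 (nm v).+1 != 0) = t v) -> arr s 14 0 = 0 ->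
  has (fun w => arr s 14 (arr s 2 (nm (hub g w u))) != 0) ws =
  [exists v, t v && (0 < conflicts g own ws u v)].
Proof.
move=> os t Ht z; apply/hasP/existsP => [[w ww]|[v /andP[tv]]].
  rewrite os.1; case e: (own _) => [v|]; last by rewrite z.
  rewrite Ht => tv; exists v; rewrite tv -has_count; apply/hasP; exists w => //.
  by rewrite e.
rewrite -has_count => /hasP[w ww /eqP e]; exists w => //.
by rewrite os.1 e Ht.
Qed.

Lemma count_indeg_spec s : var s 0 = n -> multiples G L s -> arcs_at I L s g -> ownership s ->
  (forall i, arr s 12 i = 0) ->
  wp (count_indeg ws) s (n.+1 * (bcost (count_body ws) + 10)).*2
   (fun s' => (forall v, arr s' 12 (nm v).+1 = indeg g own ws P v) /\ frame (count_indeg ws) s s').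
Proof.
move=> v0 M A os z; rewrite /count_indeg; set body := count_body ws.
have lf : loop_free body.
  by rewrite /body /= andbT /count_in loop_free_seqs all_map; apply/allP.
have [Wv Wa] := count_body_writes ws; rewrite -/body in Wv Wa.
pose Inv i s' := forall v, arr s' 12 (nm v).+1 = \sum_(u in P | nm u < i) conflicts g own ws u v.
apply: wp_frame; apply: wp_weaken (wp_for (Inv := Inv) (n := n) _ _ _ _ _ _) (leqnn _) _ => //.
- by apply/negP; rewrite inE /= => /Wv.
- by apply/negP => /Wv.
- by move=> v; rewrite /= z big1 // => u; rewrite andbF.
- move=> i s1 iN [fv fa] v5 D v; have [u ui] := num_surj I iN.
  have fa' a : a != 12 -> arr s1 a = arr s a.
    by move=> a12; apply: fa; rewrite [warrs _]/= cats0; apply/negP => /Wa; rewrite inE (negbTE a12).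
  have au : at_vertex s1 u.
    by split; [move=> j jn; rewrite fa' // M|move=> l x lL; rewrite fa' // A|rewrite v5].
  have os1 : ownership s1 by apply: ownership_frame os _ _; rewrite fa'.
  have [c1 c2 c3] := count_in_spec au os1 wsP.
  have -> : \sum_(u0 in P | nm u0 < i.+1) conflicts g own ws u0 v =
      \sum_(u0 in P | nm u0 < i) conflicts g own ws u0 v + (if u \in P then conflicts g own ws u v else 0).
    case: ifP => uP.
      rewrite (bigD1 u) /=; last by rewrite uP ui ltnS /=.
      rewrite addnC; congr (_ + _); apply: eq_bigl => x.
      by rewrite ltnS leq_eqVlt -ui num_eq; case: eqP => [->|_] /=; rewrite ?ltnn ?andbF ?andbT.
    rewrite addn0; apply: eq_bigl => x; rewrite ltnS leq_eqVlt -ui num_eq.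
    by case: eqP => [->|_] //=; rewrite uP.
  rewrite /body /count_body; cbn [den eval]; rewrite v5 -ui os1.2 ui.
  by case: ifP => _; rewrite [arr _]/= ?c3 D ?addn0.
move=> s' H v; rewrite H; apply: eq_bigl => u; by rewrite num_lt andbT.
Qed.

Record selected i s : Prop := Selected {
  sl_kept : forall v, arr s 14 (nm v).+1 != 0 -> [/\ nm v < i, v \in P & indeg g own ws P v <= 2 * size ws];
  sl_out : forall v, arr s 3 (nm v) = arr s 14 (nm v).+1;
  sl_zero : arr s 14 0 = 0;
  sl_block : forall v, (arr s 13 (nm v).+1 != 0) =
    [exists u, (arr s 14 (nm u).+1 != 0) && (0 < conflicts g own ws u v)];
  sl_indep : forall u v, arr s 14 (nm u).+1 != 0 -> arr s 14 (nm v).+1 != 0 -> u != v ->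
    conflicts g own ws u v = 0;
  sl_max : forall v, nm v < i -> v \in P -> indeg g own ws P v <= 2 * size ws ->
    arr s 14 (nm v).+1 = 0 -> exists2 u, arr s 14 (nm u).+1 != 0 &
      (0 < conflicts g own ws v u) || (0 < conflicts g own ws u v) }.

Lemma select_spec s : var s 0 = n -> multiples G L s -> arcs_at I L s g -> ownership s ->
  (forall v, arr s 12 (nm v).+1 = indeg g own ws P v) ->
  (forall a, a \in [:: 3; 13; 14] -> forall i, arr s a i = 0) ->
  wp (select ws) s (n.+1 * (bcost (select_body ws) + 10)).*2
   (fun s' => selected n s' /\ frame (select ws) s s').
Proof.
move=> v0 M A os cnt z; rewrite /select; set body := select_body ws.
have lf : loop_free body.
  rewrite /body /= /selected_test /block !loop_free_seqs !all_map !andbT.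
  by apply/andP; split; apply/allP.
have [Wv Wa] := select_body_writes ws; rewrite -/body in Wv Wa.
apply/wp_frame/(wp_for (Inv := selected)) => //.
- by apply/negP; rewrite inE /= => /Wv.
- by apply/negP => /Wv.
- split=> [v|v||v|u v|v] //=; rewrite ?z //.
  by symmetry; apply/existsP => -[u]; rewrite z.
move=> i s1 iN [fv fa] v5 [D1 D2 D3 D4 D5 D6]; have [v vi] := num_surj I iN.
have fa' a : a \notin [:: 3; 13; 14] -> arr s1 a = arr s a.
  by move=> an; apply: fa; rewrite [warrs _]/= cats0; apply: contra an => /Wa.
have av : at_vertex s1 v.
  by split; [move=> j jn; rewrite fa' // M|move=> l x lL; rewrite fa' // A|rewrite v5].
have os1 : ownership s1 by apply: ownership_frame os _ _; rewrite fa'.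
(* This covers all cases in which [v] is passed over: the arrays do not change, and only the reason
   for passing over [v] remains to be given. *)
have keep : (v \in P -> indeg g own ws P v <= 2 * size ws -> exists2 u, arr s1 14 (nm u).+1 != 0 &
      (0 < conflicts g own ws v u) || (0 < conflicts g own ws u v)) ->
    forall s2, arr s2 = arr s1 -> selected i.+1 (set_var s2 5 i.+1).
  move=> H s2 e; split; rewrite [arr _]/= e //.
    by move=> u /D1 [h1 h2 h3]; split=> //; apply: leqW.
  move=> u; rewrite ltnS leq_eqVlt -vi num_eq => /orP[/eqP ->|ui] uP ud u0; first exact: H.
  by apply: D6 => //; rewrite -vi.
rewrite /body /select_body; cbn [den eval].
rewrite v5 -vi os1.2; case: ifP => [vP|nP]; last by rewrite vi; apply: keep => //; rewrite nP.
rewrite addn1 fa' // cnt subn_eq0 -ltnNge ltnS; case: leqP => [vd|nd]; last first.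
  by rewrite vi; apply: keep => // _; rewrite leqNgt nd.
have Hc u : (arr s1 13 (nm u).+1 != 0) = [exists x, (arr s1 14 (nm x).+1 != 0) && (0 < conflicts g own ws x u)].
  exact: D4.
rewrite Hc; case: existsP => [[u /andP[u1 u2]]|nblock].
  by rewrite vi; apply: keep => // _ _; exists u; rewrite ?u2 ?orbT.
pose s1' := set_var s1 7 0.
have av' : at_vertex s1' v by apply: at_vertex_frame av _ _ _.
have [|t1 t2 t3] := @test_spec (fun w => Get 14 (owner_expr w))
    (fun w => arr s1 14 (arr s1 2 (nm (hub g w v)))) s1' v ws av'.
  move=> s2 w a2 e2 ww; rewrite /= (eval_word a2) ?e2 //; exact: (allP wsP).
rewrite -/(selected_test ws) in t1 t2 t3.
rewrite -/s1'; move: (den (selected_test ws) _) t1 t2 t3 => s2 t1 t2 t3.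
rewrite t3 (_ : var s1' 7 = 0) //= (conflict_test v os1 (fun u => erefl _) D3).
case: existsP => [[u /andP[u1 u2]]|nhit].
  by rewrite vi; apply: keep => // _ _; exists u; rewrite ?u2.
have v52 : var s2 5 = nm v by rewrite t2 //= /upd /= v5.
have {}t1 : arr s2 = arr s1 by rewrite t1.
rewrite v52 addn1.
set s3 := set_arr _ _ _ _.
have av3 : at_vertex s3 v by apply: at_vertex_frame av _ _ _; rewrite /= /upd /= ?t1 // v52 v5.
have os3 : ownership s3 by apply: ownership_frame os1 _ _; rewrite /= /upd /= t1.
have [c1 c2 c3] := block_spec av3 os3 wsP.
move: (den _ s3) c1 c2 c3 => s4 c1 c2 c3.
have E14 u : arr s4 14 (nm u).+1 = if u == v then 1 else arr s1 14 (nm u).+1.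
  by rewrite c2 //= /upd /= eqSS num_eq t1.
have E3 u : arr s4 3 (nm u) = if u == v then 1 else arr s1 3 (nm u).
  by rewrite c2 //= /upd /= num_eq t1.
have E13 u : (arr s4 13 (nm u).+1 != 0) = (arr s1 13 (nm u).+1 != 0) || (0 < conflicts g own ws v u).
  by rewrite c3 /= /upd /= t1.
have nb u : arr s1 14 (nm u).+1 != 0 -> conflicts g own ws u v = 0.
  by move=> u1; apply/eqP/negPn/negP => u2; apply: nblock; exists u; rewrite u1 lt0n.
have nh u : arr s1 14 (nm u).+1 != 0 -> conflicts g own ws v u = 0.
  by move=> u1; apply/eqP/negPn/negP => u2; apply: nhit; exists u; rewrite u1 lt0n.
rewrite vi; split; rewrite [arr _]/=.
- move=> u; rewrite E14; case: (eqVneq u v) => [->|uv]; first by rewrite vi.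
  by case/D1 => h1 h2 h3; split=> //; apply: leqW.
- by move=> u; rewrite E3 E14 D2.
- by rewrite c2 //= /upd /= t1.
- move=> u; rewrite E13 D4; apply/orP/existsP => [[/existsP[x /andP[x1 x2]]|h]|[x]].
  + by exists x; rewrite E14 x2 andbT; case: (x == v).
  + by exists v; rewrite E14 eqxx.
  rewrite E14; case: (eqVneq x v) => [->|_] /andP[x1 x2]; [by right|left].
  by apply/existsP; exists x; rewrite x1.
- move=> u x; rewrite !E14; case: (eqVneq u v) (eqVneq x v) => [->|uv] [->|xv]; rewrite ?eqxx // => h1 h2 h3.
  + exact: nh.
  + exact: nb.
  exact: D5.
move=> u; rewrite ltnS leq_eqVlt -vi num_eq E14; case: (eqVneq u v) => //= _ ui uP ud u0.
have [|//|//|//|x x1 x2] := D6 u; first by rewrite -vi.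
by exists x => //; rewrite E14; case: (x == v).
Qed.
End Select.
End Greedy.

(** * The complete algorithm *)

Definition algorithm f k :=
  let m := 2 * k + 1 in
  let wts := (params f m).1 in
  Seq (init_prog (size wts)) (Seq (levels f m) (Seq (dominate (words wts k))
    (Seq (count_indeg (words wts m)) (select (words wts m))))).

Lemma tame0_seqs (T : Type) (F : T -> cmd) (ps : seq T) :
  (forall p, tame0 (F p)) -> tame0 (seqs [seq F p | p <- ps]).
Proof. by move=> H; elim: ps => //= p ps ->; rewrite H. Qed.

Lemma tame0_levels f d : tame0 (levels f d).
Proof.
elim: d => //= d ->; rewrite /= !andbT; apply: tame0_seqs => p.
by rewrite /fork_cmd.
Qed.

Lemma tame0_algorithm f k : tame0 (algorithm f k).
Proof.
rewrite /algorithm; set m := 2 * k + 1.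
rewrite /= tame0_levels ?andbT /=.
rewrite /dominate /dominate_body /count_indeg /count_body /select /select_body /=.
by rewrite /owned_test /claim /count_in /selected_test /block !tame0_seqs.
Qed.

(** Offsets are at most the degree sum, which is linear by sparsity; all other cells are at most the
    number of vertices. *)
Lemma input_bounded (G : sgraph) (I : adjlists G) f :
  (forall r S H, subgraph S G -> contraction r S H -> #|edges H| <= f r * #|{: H}|) ->
  bounded ((2 * f 1 + 1) * #|{: G}|.+1) (input I).
Proof.
move=> ex; have ds := degree_sum_le I ex; split=> [x|[|[|a]] i] //=.
- by case: ifP => // _; nia.
- case: ifP => // ii; have : arr (input I) 0 i <= degree_sum I by apply: offset_mono.
  rewrite /= ii => h; apply: leq_trans h (leq_trans ds _).
  by apply: leq_mul; rewrite ?leq_addr.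
set s := flatten _; have [|h] := ltnP i (size s); last by rewrite nth_default.
move=> /(mem_nth 0) /flattenP [_ /mapP[v _ ->] /mapP[w _ ->]].
apply: leq_trans (ltnW (num_lt I w)) _.
by rewrite mulnDl mul1n; apply: leq_trans (leqnSn _) (leq_addl _ _).
Qed.

Section Main.
Variables (f : nat -> nat) (k : nat) (G : sgraph) (I : adjlists G).
Hypothesis expansion :
  forall r S H, subgraph S G -> contraction r S H -> #|edges H| <= f r * #|{: H}|.
Notation m := (2 * k + 1).
Notation wts := (params f m).1.
Notation n := (#|{: G}|).

Definition algorithm_time :=
  init_time (size wts) + levels_time f m + 2 * (bcost (dominate_body (words wts k)) + 10)
  + 2 * (bcost (count_body (words wts m)) + 10) + 2 * (bcost (select_body (words wts m)) + 10) + 4.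

Lemma algorithm_spec :
  wp (algorithm f k) (input I) (algorithm_time * n.+1) (fun s =>
    let D := output I s 2 in
    let A := output I s 3 in
    [/\ k_dominating k D, d_independent m A &
      #|D| <= size (words wts k) * (2 * (1 + 3 * size (words wts m))) * #|A|]).
Proof.
have wk r : all (word wts) (words wts r).
  by apply/allP => w; rewrite mem_words ?params_pos // => /andP[].
apply: (wp_weaken (T := (init_time (size wts) * n.+1 + (levels_time f m * n.+1 +
  ((n.+1 * (bcost (dominate_body (words wts k)) + 10)).*2 +
  ((n.+1 * (bcost (count_body (words wts m)) + 10)).*2 +
  (n.+1 * (bcost (select_body (words wts m)) + 10)).*2).+1).+1).+1).+1)); last 2 first.
- by rewrite /algorithm_time; nia.
- exact: (fun s H => H).
apply: wp_seq (init_prog_spec I (size wts)) _ => s1 [R1 Z1].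
apply: wp_seq (levels_spec expansion (leqnn _) R1) _ => s2 [g [mk [R2 fa2]]].
have Z2 a : a \in [:: 2; 3; 11; 12; 13; 14] -> forall i, arr s2 a i = 0.
  by move=> aa i; rewrite fa2 ?Z1 //; move: aa; rewrite !inE; lia.
have [[v0 _ _] M2 A2 Hl _ _ _ _] := R2.
apply: wp_seq (dominate_spec (wk k) v0 M2 A2 (Z2 2 isT) (Z2 11 isT)) _ => s3.
case=> -[D1 D2 D3] /(frame_for (dominate_body_writes _)) [fv3 fa3].
(* The owner map is decoded from array 2, which stores vertex numbers shifted by one so that 0 means
   no owner. *)
pose own x := [pick v | arr s3 2 (num I x) == (num I v).+1].
pose P := [set v | arr s3 11 (num I v) != 0].
have ownE x v : (own x = Some v) <-> arr s3 2 (num I x) = (num I v).+1.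
  rewrite /own; case: pickP => [u /eqP ->|H].
    by split=> [[->//]|[/eqP]]; rewrite num_eq => /eqP ->.
  by split=> // E; have := H v; rewrite E eqxx.
have os : ownership I own P s3.
  split=> [x|v]; last by rewrite inE.
  case E: (own x) => [v|]; first exact/ownE.
  apply/eqP/negPn/negP => /D1 [v [/ownE]]; by rewrite E.
have v03 : var s3 0 = n by rewrite fv3.
have M3 : multiples G (size wts) s3 by move=> j jn; rewrite fa3 // M2.
have A3 : arcs_at I (size wts) s3 g by move=> l v lL; rewrite fa3 // A2.
have Z12 i : arr s3 12 i = 0 by rewrite fa3 // Z2.
apply: wp_seq (count_indeg_spec (wk m) v03 M3 A3 os Z12) _ => s4.
case=> H4 /(frame_for (count_body_writes _)) [fv4 fa4].
have v04 : var s4 0 = n by rewrite fv4.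
have M4 : multiples G (size wts) s4 by move=> j jn; rewrite fa4 // M3.
have A4 : arcs_at I (size wts) s4 g by move=> l v lL; rewrite fa4 // A3.
have os4 : ownership I own P s4 by apply: ownership_frame os _ _; rewrite fa4.
have Z4 a : a \in [:: 3; 13; 14] -> forall i, arr s4 a i = 0.
  by move=> aa i; rewrite fa4 ?fa3 ?Z2 //; move: aa; rewrite !inE; lia.
apply: wp_weaken (select_spec (wk m) v04 M4 A4 os4 H4 Z4) (leqnn _) _ => s5.
case=> -[S1 S2 _ _ S5 S6] /(frame_for (select_body_writes _)) [_ fa5].
have DE : output I s5 2 = [set x | own x != None].
  apply/setP => x; rewrite !inE fa5 // fa4 // os.1.
  by case: (own x).
have AE x : (x \in output I s5 3) = (arr s5 14 (num I x).+1 != 0) by rewrite inE S2.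
have ownP x v : own x = Some v -> v \in P /\ exists2 w, w \in words wts k & hub g w v = x.
  move=> /ownE E; have [|u [E' uP uw]] := D1 x; first by rewrite E.
  have -> : v = u by apply/eqP; rewrite -(num_eq I) -eqSS -E -E'.
  by rewrite inE.
have own_hub v w : v \in P -> w \in words wts k -> own (hub g w v) = Some v.
  by rewrite inE => vP ww; apply/ownE/D2.
have nP v : v \notin P -> exists2 w, w \in words wts k & own (hub g w v) != None.
  rewrite inE negbK => /eqP vP; have [w ww] := D3 v (num_lt I v) vP.
  by rewrite os.1 => h; exists w => //; case: (own _) h.
have AP : output I s5 3 \subset
    [set v in P | indeg g own (words wts m) P v <= 2 * size (words wts m)].
  by apply/subsetP => v; rewrite AE => /S1 [_ h1 h2]; rewrite inE h1.
have Ai u v : u \in output I s5 3 -> v \in output I s5 3 -> u != v ->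
    conflicts g own (words wts m) u v = 0.
  by rewrite !AE; apply: S5.
have Am u : u \in P -> indeg g own (words wts m) P u <= 2 * size (words wts m) ->
    u \notin output I s5 3 -> exists2 v, v \in output I s5 3 &
    (0 < conflicts g own (words wts m) u v) || (0 < conflicts g own (words wts m) v u).
  rewrite AE negbK => uP uI /eqP u0; have [v v1 v2] := S6 u (num_lt I u) uP uI u0.
  by exists v; rewrite ?AE.
have pos := params_pos f m.
rewrite /= DE; split.
- exact: (own_dominating Hl pos own_hub nP).
- exact: (A_independent Hl pos own_hub AP Ai).
exact: (card_own_A ownP AP Am).
Qed.
End Main.

Theorem theorem7 (GG : sgraph -> Prop) (k : nat)
  (hGG : bounded_expansion GG) (hk : 1 <= k) :
  exists (C : nat) (P : cmd) (T w : nat),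
    forall (G : sgraph), GG G -> forall I : adjlists G,
      exists (t : nat) (s : state),
        [/\ exec (#|{: G}|.+2 ^ w) P (input I) t s,
            t <= T * #|{: G}|.+1 &
            let D := output I s 2 in
            let A := output I s 3 in
            [/\ k_dominating k D,
                d_independent (2 * k + 1) A &
                #|D| <= C * #|A|]].
Proof.
case: hGG => f Hf.
set wts := (params f (2 * k + 1)).1.
set T := algorithm_time f k; set K := tame_const (algorithm f k).
exists (size (words wts k) * (2 * (1 + 3 * size (words wts (2 * k + 1))))), (algorithm f k), T,
  (K + (2 * f 1 + 1 + T * K + K) + 2) => G /Hf ex I.
have [t [s [E tT Q]]] := algorithm_spec k I ex.
exists t, s; split=> //.
exact: (run_exec E (tame0_algorithm f k) (erefl _) (input_bounded I ex) tT).
Qed.
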